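(* Let a fixed integer $\ell\ge 1$ be given, and let $m=m(n)$ be a sequence of non-negative integers such that \[ m\le \frac{2}{\pi^2}\,n\Bigl(\log n-\tfrac12(\ell+2)\log\log n-\omega(n)\Bigr), \] where $\omega(n)\to\infty$ (however slowly) as $n\to\infty$. Put $q=\frac{m}{m+n}$. Then, as $n\to\infty$, \[ [x^m y^n]\,T(x,y)^{\ell}\sim \ell\,\bigl(2f(q)\bigr)^{\ell-1}\binom{n+m-1}{n-1}C_n\prod_{j\ge1}(1-q^j)^3 . \]
   Context: A chord diagram with $n$ chords is a pairing of the $2n$ points labeled $1,\dots,2n$; the chords $\{a,b\}$, $\{c,d\}$ with $a<b$, $c<d$ cross if $a<c<b<d$ or $c<a<d<b$. $T_{n,m}$ is the number of chord diagrams with $n$ chords and exactly $m$ crossing pairs of chords (with $T_{0,0}=1$ and $T_{0,m}=0$ for $m>0$), and $T(x,y)=\sum_{n,m\ge0}T_{n,m}x^my^n$ as a formal power series; $[x^my^n]$ denotes coefficient extraction. $C_n=\frac1{n+1}\binom{2n}{n}$ is the $n$-th Catalan number, and $f(x)=\sum_{j\ge0}(-1)^jx^{j(j+1)/2}$ for $0\le x<1$. The notation $a_n\sim b_n$ means $a_n/b_n\to1$. *)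

(* Defs.v *)
From HB Require Import structures.
From mathcomp Require Import all_boot all_order all_algebra.
From mathcomp Require Import all_classical all_reals all_analysis.
Set Implicit Arguments.
Unset Strict Implicit.
Unset Printing Implicit Defensive.
Import Order.TTheory GRing.Theory Num.Theory.
Import numFieldNormedType.Exports.
Local Open Scope classical_set_scope.
Local Open Scope ring_scope.

(* The 2n points are 0, ..., 2n-1; a diagram is its set of chords. *)
Definition chord_diagram (n : nat) (P : {set {set 'I_n.*2}}) : bool :=
  finset.partition P [set: 'I_n.*2]%SET && [forall A in P, #|A| == 2%N].

Definition crossing (k : nat) (A B : {set 'I_k}) : bool :=
  [exists a : 'I_k, exists b : 'I_k, exists c : 'I_k, exists d : 'I_k,
    [&& A == [set a; b]%SET, B == [set c; d]%SET, (a < b)%N, (c < d)%N &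
        [&& (a < c)%N, (c < b)%N & (b < d)%N] ||
        [&& (c < a)%N, (a < d)%N & (d < b)%N]]].

(* Crossing pairs are unordered, hence counted as two-element sets. *)
Definition crossings (k : nat) (P : {set {set 'I_k}}) : nat :=
  #|[set [set A; B] | A in P, B in P & crossing A B]%SET|.

Definition T_num (n m : nat) : nat :=
  #|[set P : {set {set 'I_n.*2}} | chord_diagram P & crossings P == m]%SET|.

(* A formal power series in x and y; [a m n] is the coefficient of x^m y^n. *)
Definition fps2 (R : pzSemiRingType) : Type := nat -> nat -> R.

Definition fps2_one (R : pzSemiRingType) : fps2 R :=
  fun m n => ((m == 0%N) && (n == 0%N))%:R.

Definition fps2_mul (R : pzSemiRingType) (a b : fps2 R) : fps2 R :=
  fun m n => \sum_(i < m.+1) \sum_(j < n.+1) a i j * b (m - i)%N (n - j)%N.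

Definition fps2_exp (R : pzSemiRingType) (a : fps2 R) (l : nat) : fps2 R :=
  iter l (fps2_mul a) (fps2_one R).

Definition T_fps (R : pzSemiRingType) : fps2 R := fun m n => (T_num n m)%:R.

Definition catalan (R : realType) (n : nat) : R :=
  n.+1%:R^-1 * 'C(n.*2, n)%:R.

(* [limn] is only meaningful on a convergent sequence; the two below converge
   for 0 <= x < 1, the only range in which they are used. *)
Definition f_series (R : realType) (x : R) : R :=
  limn (fun N : nat => \sum_(0 <= j < N) (-1) ^+ j * x ^+ ((j * j.+1)./2)%N).

Definition euler_prod3 (R : realType) (x : R) : R :=
  limn (fun N : nat => \prod_(1 <= j < N.+1) (1 - x ^+ j) ^+ 3).

Definition asymp_equiv (R : realType) (a b : nat -> R) : Prop :=
  (fun n : nat => a n / b n) @ \oo --> (1 : R).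

(* Main.v *)
Require Import Defs.
From HB Require Import structures.
From mathcomp Require Import all_boot all_order all_algebra.
From mathcomp Require Import fingroup perm.
From mathcomp Require Import all_classical all_reals all_analysis.
From mathcomp Require Import ring lra zify.
Import Order.TTheory GRing.Theory Num.Theory.
Import numFieldNormedType.Exports.
Local Open Scope classical_set_scope.
Local Open Scope ring_scope.

(** Scan the 2n points from left to right and remember how many chords are
    open.  Closing the i-th innermost of h open chords creates i - 1 crossings,
    so the polynomial T_n(x) = sum_m T_{n,m} x^m counts Dyck paths in which a
    down step from height h has weight 1 + x + ... + x^(h-1) ([match_gfS]).
    This recurrence has a closed solution, which for closed diagrams is the
    Touchard-Riordan formula ([touchard_riordan])

      (1 - x)^n T_n(x) = sum_j (-1)^j x^tri(j) [z^(n-j)] Cat(z)^(2j+1),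

    where tri(j) = j(j+1)/2 and Cat is the Catalan series.  Multiplying l such
    series only multiplies powers of Cat, hence ([fps2_exp_boxsum])

      [x^m y^n] T^l = sum_k (-1)^K [z^(n-K)] Cat^(2K+l) [x^(m-J)] (1-x)^(-n),

    the sum being over k = (k_1, ..., k_l), K = k_1 + ... + k_l and
    J = tri(k_1) + ... + tri(k_l).

    For fixed k the first coefficient is close to 2^(l-1) (2K+l) C_n and the
    second one to q^J binomial(n+m-1, n-1).  After this replacement the sum
    factors as l (2 f(q))^(l-1) theta(q), with
    theta(q) = sum_k (-1)^k (2k+1) q^tri(k), and theta(q) = prod (1 - q^j)^3 by
    Jacobi ([theta_sum_cvg]).

    The difficulty is that the product is tiny when q tends to 1, so the error
    must be compared with it.  Put lambda = m/n, so that 1 - q = 1/(1+lambda).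
    - The replacement costs a relative error O((1 + K^2)/n) in the first
      coefficient ([ballot_catalan_err]) and an error of order 1/n, up to a
      slightly slower decay in J, in the second one ([negbin_err]).  Summing
      absolute values, with K^2 = O(J), J of order 1 + lambda, and
      sum_k q^tri(k) = O((1+lambda)^(1/2)), the total error is
      O((1+lambda)^((l+4)/2) / n) ([main_error]).
    - The product is at least c (1+lambda) exp(- pi^2 lambda / 2)
      ([qpoch3_ge]).  Indeed - sum_j log(1 - q^j) = sum_i (1/i) q^i/(1 - q^i),
      and q^i/(1 - q^i) <= lambda/i gives the exponent through
      sum 1/i^2 = pi^2/6; saving (i-1)/(3i) in each of the terms i <= lambda
      gains a third of a harmonic sum, which after cubing is the factor
      1 + lambda.
    The hypothesis on m says that exp(- pi^2 lambda / 2) is at least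
    exp(omega) (log n)^((l+2)/2) / n, and it forces 1 + lambda = O(log n), so
    the ratio of error and main term is O(exp(- omega)) ([exp_bound]). *)

Set Implicit Arguments.
Unset Strict Implicit.
Unset Printing Implicit Defensive.


(** * Chord diagrams scanned from left to right *)

(** A partial matching of the points below k, encoded as an involution of a
    fixed type: the points not yet matched, and all points from k on, are
    fixed.  Working inside one type lets a chord be added by multiplying with
    a transposition. *)
Definition matching_upto (N k : nat) (s : {perm 'I_N}) : bool :=
  [forall i, s (s i) == i] && [forall i : 'I_N, (k <= i)%N ==> (s i == i)].

Definition free_pts (N k : nat) (s : {perm 'I_N}) : {set 'I_N} :=
  [set i : 'I_N | (i < k)%N && (s i == i)]%SET.

(** Pairs of left endpoints (a, c) of crossing chords, where an unmatched c is
    regarded as the left endpoint of a chord that ends at infinity. *)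
Definition cross_pairs (N : nat) (s : {perm 'I_N}) : {set 'I_N * 'I_N} :=
  [set p : 'I_N * 'I_N | [&& (p.1 < p.2)%N, (p.2 < s p.1)%N &
      (s p.2 == p.2) || (s p.1 < s p.2)%N]]%SET.

Definition match_gf (S : comNzRingType) (x : S) (N k h : nat) : S :=
  \sum_(s : {perm 'I_N} | matching_upto k s && (#|free_pts k s| == h))
     x ^+ #|cross_pairs s|.

(** The elements of F have respectively 0, 1, ..., #|F| - 1 larger elements. *)
Lemma sum_rank (S : comNzRingType) (x : S) (N : nat) (F : {set 'I_N}) :
  \sum_(i in F) x ^+ #|[set c in F | (i < c)%N]%SET| = \sum_(t < #|F|) x ^+ t.
Proof.
have [h] := ubnP #|F|; elim: h F => // h IH F.
have [->|[i0 i0F]] := finset.set_0Vmem F; first by rewrite cards0 big_ord0 big_set0.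
rewrite ltnS => Fh.
case: (arg_minnP (fun i : 'I_N => i : nat) i0F) => a aF' amin.
have aF : a \in F := aF'.
have cF : #|F| = #|(F :\ a)%SET|.+1 by rewrite (cardsD1 a) aF.
rewrite (big_setD1 a) //= cF big_ord_recr /= addrC.
congr (_ + _); last first.
  congr (x ^+ _); apply: eq_card => c; rewrite !inE andbC.
  case cFb : (c \in F); rewrite ?andbF //= !andbT.
  by rewrite ltn_neqAle amin // andbT eq_sym.
rewrite -IH; last by rewrite -cF.
apply: eq_bigr => i; rewrite !inE => /andP[ia iF]; congr (x ^+ _).
apply: eq_card => c; rewrite !inE; case: eqVneq => [->|//] /=.
by rewrite aF /=; apply/negbTE; rewrite -leqNgt amin.
Qed.

Lemma matching_uptoP (N k : nat) (s : {perm 'I_N}) :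
  reflect (involutive s /\ forall i : 'I_N, (k <= i)%N -> s i = i)
          (matching_upto k s).
Proof.
apply: (iffP andP) => [[/forallP H1 /forallP H2]|[H1 H2]]; split.
- by move=> i; apply/eqP.
- by move=> i ki; apply/eqP; move: (H2 i); rewrite ki.
- by apply/forallP => i; apply/eqP.
- by apply/forallP => i; apply/implyP => ki; apply/eqP/H2.
Qed.

Section AddChord.
Variables (N : nat) (K : 'I_N).

Lemma matching_upto_open (s : {perm 'I_N}) :
  matching_upto K.+1 s && (s K == K) = matching_upto K s.
Proof.
apply/idP/idP => [/andP[/matching_uptoP[si sf] /eqP sK]|/matching_uptoP[si sf]].
  apply/matching_uptoP; split=> // i; rewrite leq_eqVlt => /orP[/eqP Ki|/sf//].
  by have -> : i = K by apply/val_inj.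
by apply/andP; split; [apply/matching_uptoP; split=> // i /ltnW /sf|rewrite sf].
Qed.

Lemma free_pts_open (s : {perm 'I_N}) : s K = K ->
  #|free_pts K.+1 s| = #|free_pts K s|.+1.
Proof.
move=> sK; have -> : free_pts K.+1 s = (K |: free_pts K s)%SET.
  apply/finset.setP => i; rewrite !inE ltnS leq_eqVlt val_eqE.
  by case: (eqVneq i K) => [->|//]; rewrite sK eqxx.
by rewrite cardsU1 inE ltnn.
Qed.

Variable i : 'I_N.

Lemma swapE (s : {perm 'I_N}) : s i = i -> s K = K -> forall x,
  (s * tperm i K)%g x = if x == i then K else if x == K then i else s x.
Proof.
move=> si sK x; rewrite permM.
case: eqVneq => [->|xi]; first by rewrite si tpermL.
case: eqVneq => [->|xK]; first by rewrite sK tpermR.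
by rewrite tpermD // eq_sym; [rewrite -si|rewrite -sK]; rewrite (inj_eq perm_inj).
Qed.

Lemma matching_upto_close (s : {perm 'I_N}) :
  [&& matching_upto K.+1 (s * tperm i K)%g, (s * tperm i K)%g K == i & i != K]
  = matching_upto K s && (i \in free_pts K s).
Proof.
apply/idP/idP.
  move=> /and3P[/matching_uptoP[si sf] /eqP sK iK].
  have s0K : s K = K by move: sK; rewrite permM => /(canRL (tpermK _ _)); rewrite tpermL.
  have s0i : s i = i.
    by move: (si K); rewrite sK permM => /(canRL (tpermK _ _)); rewrite tpermR.
  have E := swapE s0i s0K.
  have ltiK : (i < K)%N.
    rewrite ltnNge leq_eqVlt negb_or eq_sym; apply/andP; split=> //.
    by apply/negP => /sf; rewrite E eqxx => /esym/eqP; apply/negP.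
  rewrite inE ltiK s0i eqxx !andbT; apply/matching_uptoP; split=> [x|x].
    case: (eqVneq x i) => [->|xi]; first by rewrite !s0i.
    case: (eqVneq x K) => [->|xK]; first by rewrite !s0K.
    have := si x; rewrite (E x) (negbTE xi) (negbTE xK) E.
    have -> : (s x == i) = false by apply/negbTE; rewrite -s0i (inj_eq perm_inj).
    by have -> : (s x == K) = false by apply/negbTE; rewrite -s0K (inj_eq perm_inj).
  rewrite leq_eqVlt => /orP[/eqP Kx|Kx].
    by have -> : x = K by apply/val_inj.
  have := sf x Kx; rewrite E.
  have -> : (x == i) = false by apply/negbTE; apply/eqP => xi; move: ltiK; rewrite -xi; lia.
  by have -> : (x == K) = false by apply/negbTE; apply/eqP => xi; move: Kx; rewrite xi; lia.
move=> /andP[/matching_uptoP[si sf]]; rewrite inE => /andP[ltiK /eqP s0i].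
have s0K : s K = K by apply: sf.
have E := swapE s0i s0K.
have niK : i != K by apply/eqP => iK; move: ltiK; rewrite iK ltnn.
have nKi : K != i by rewrite eq_sym.
rewrite niK E eqxx (negbTE nKi) eqxx !andbT.
apply/matching_uptoP; split=> x.
  rewrite (E x); case: (eqVneq x i) => [->|xi].
    by rewrite E eqxx (negbTE nKi).
  case: (eqVneq x K) => [->|xK]; first by rewrite E eqxx.
  rewrite E si.
  have -> : (s x == i) = false by apply/negbTE; rewrite -s0i (inj_eq perm_inj).
  by have -> : (s x == K) = false by apply/negbTE; rewrite -s0K (inj_eq perm_inj).
move=> Kx; rewrite E.
have -> : (x == i) = false by apply/negbTE; apply/eqP => xi; move: ltiK; rewrite -xi; lia.
have -> : (x == K) = false by apply/negbTE; apply/eqP => xi; move: Kx; rewrite xi; lia.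
by apply/sf/ltnW.
Qed.

Lemma free_pts_close (s : {perm 'I_N}) : matching_upto K s ->
  i \in free_pts K s ->
  #|free_pts K s| = #|free_pts K.+1 (s * tperm i K)%g|.+1.
Proof.
move=> /matching_uptoP[si sf] iF; rewrite (cardsD1 i) iF add1n.
move: iF; rewrite inE => /andP[ltiK /eqP s0i].
have s0K : s K = K by apply: sf.
congr _.+1; apply: eq_card => x; rewrite !inE swapE // ltnS.
case: (eqVneq x i) => [->|xi] /=.
  by rewrite andbC; apply/esym; case: eqP => //= iK; rewrite iK ltnn in ltiK.
case: (eqVneq x K) => [xK|xK].
  by move: xi; rewrite xK ltnn /= eq_sym => /negbTE ->; rewrite andbF.
by rewrite [(x <= K)%N]leq_eqVlt val_eqE (negbTE xK).
Qed.

(** Crossings with an open chord are already counted as crossings with a chord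
    going to infinity, so closing the chord of i at K only adds the chords
    opened after i and still open. *)
Lemma cross_pairs_close (s : {perm 'I_N}) : matching_upto K s ->
  i \in free_pts K s ->
  #|cross_pairs (s * tperm i K)%g| =
  (#|cross_pairs s| + #|[set c in free_pts K s | (i < c)%N]%SET|)%N.
Proof.
move=> /matching_uptoP[si sf]; rewrite inE => /andP[ltiK /eqP s0i].
have s0K : s K = K by apply: sf.
have E := swapE s0i s0K.
have inj : injective (fun c : 'I_N => (i, c)) by move=> c d [].
rewrite -(card_imset _ inj).
have up (y : 'I_N) : (K <= s y)%N -> s y = y by move=> /sf; rewrite si.
rewrite -cardsUI [X in (_ + #|pred_of_set X|)%N](_ : _ = finset.set0); last first.
  apply/finset.setP => -[a c]; rewrite !inE; apply/negP => /andP[/and3P[/= h1 h2 _]].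
  by move=> /imsetP[d _ [ai _]]; move: h1 h2; rewrite ai s0i; lia.
rewrite cards0 addn0; apply: eq_card => -[a c].
rewrite finset.in_setU [X in _ || X](_ : _ =
    (a == i) && [&& (c < K)%N, s c == c & (i < c)%N]); last first.
  apply/imsetP/andP => [[d]|[/eqP -> H]].
    by rewrite !inE => H [-> ->]; rewrite eqxx; move: H; rewrite -andbA.
  by exists c => //; rewrite !inE -andbA.
rewrite !inE /= !E.
case: (eqVneq a i) => [->|ai] /=.
  rewrite s0i.
  have -> : [&& (i < c)%N, (c < i)%N & (s c == c) || (i < s c)%N] = false by lia.
  case: (eqVneq c i) => [->|ci]; first by rewrite ltnn !andbF.
  case: (eqVneq c K) => [->|cK]; first by rewrite ltnn !andbF.
  case: (ltnP c K) => cltK; rewrite ?andbF //= [RHS]andbC.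
  congr (_ && _); case: eqP => //= sc; apply/negbTE; rewrite -leqNgt leqNgt.
  by apply/negP => Ksc; apply: sc; apply: up; apply: ltnW.
rewrite orbF; case: (eqVneq a K) => [->|aK].
  rewrite s0K; case: (ltnP K c) => //= Kc; have -> : (c < i)%N = false by lia.
  by have -> : (c < K)%N = false by lia.
case: (ltnP a c) => //= ac; case: (ltnP c (s a)) => //= csa.
have saK : (s a < K)%N.
  rewrite ltnNge; apply/negP => /up saa; move: csa; rewrite saa; lia.
case: (eqVneq c i) => [->|ci]; first by rewrite s0i eqxx saK orbT.
by case: (eqVneq c K) => // cK; move: csa; rewrite cK; lia.
Qed.

End AddChord.

(** Point K either opens a chord or closes one of the h + 1 open ones; in the
    latter case [sum_rank] collects the powers of x. *)
Lemma match_gfS (S : comNzRingType) (x : S) (N : nat) (K : 'I_N) (h : nat) :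
  match_gf x N K.+1 h =
    (if h is h'.+1 then match_gf x N K h' else 0) +
    (\sum_(t < h.+1) x ^+ t) * match_gf x N K h.+1.
Proof.
rewrite /match_gf.
rewrite (bigID (fun s : {perm 'I_N} => s K == K)) /=; congr (_ + _).
  have P0 s : matching_upto K.+1 s && (#|free_pts K.+1 s| == h) && (s K == K)
     = matching_upto K s && (#|free_pts K s|.+1 == h).
    rewrite -(matching_upto_open K s); case: (s K =P K) => sK.
      by rewrite !andbT free_pts_open.
    by rewrite !andbF.
  rewrite (eq_bigl _ _ P0); case: h {P0} => [|h]; last exact: eq_bigl.
  by apply: big1 => s /andP[].
transitivity (\sum_(i : 'I_N) \sum_(s : {perm 'I_N} |
    (matching_upto K s && (#|free_pts K s| == h.+1)) && (i \in free_pts K s))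
    x ^+ #|cross_pairs (s * tperm i K)%g|).
  rewrite (partition_big (fun s : {perm 'I_N} => s K) xpredT) //=.
  apply: eq_bigr => i _; rewrite (reindex_inj (mulIg (tperm i K))) /=.
  apply: eq_bigl => s.
  have := matching_upto_close K i s; rewrite /= => H.
  apply/idP/idP.
    move=> /andP[/andP[/andP[h1 h2] h3] h4].
    have : matching_upto K s && (i \in free_pts K s).
      by rewrite -H h1 h4 /= -(eqP h4).
    by case/andP=> h5 h6; rewrite h5 h6 (free_pts_close h5 h6) // andbT eqSS.
  move=> /andP[/andP[h1 h2] h3].
  move: H; rewrite h1 h3 => /and3P[h4 h5 h6].
  rewrite h4 h5 (eqP h5) h6 !andbT /=.
  by move: h2; rewrite (free_pts_close h1 h3) eqSS.
rewrite (exchange_big_dep (fun s => matching_upto K s && (#|free_pts K s| == h.+1))) /=; last first.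
  by move=> i s _ /andP[].
rewrite mulr_sumr; apply: eq_bigr => s /andP[h1 /eqP h2].
rewrite -h2 -sum_rank mulr_suml; apply: eq_big => [i|i iF]; first by rewrite h1 h2 eqxx.
by case/andP: iF => _ iF; rewrite -exprD addnC -(cross_pairs_close h1 iF).
Qed.

Lemma match_gf0 (S : comNzRingType) (x : S) (N h : nat) :
  match_gf x N 0 h = (h == 0%N)%:R.
Proof.
rewrite /match_gf.
have P s : matching_upto 0 s && (#|free_pts 0 s| == h) = (h == 0%N) && (s == 1%g :> {perm 'I_N}).
  have -> : free_pts 0 s = finset.set0 by apply/finset.setP => i; rewrite !inE ltn0.
  rewrite cards0 eq_sym andbC; congr (_ && _).
  apply/matching_uptoP/eqP => [[_ H]|->]; first by apply/permP => i; rewrite perm1 H.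
  by split=> i; rewrite !perm1.
rewrite (eq_bigl _ _ P); case: eqP => _ /=; last by rewrite big_pred0.
rewrite big_pred1_eq.
have -> : cross_pairs (1%g : {perm 'I_N}) = finset.set0.
  by apply/finset.setP => -[a c]; rewrite !inE !perm1 /=; lia.
by rewrite cards0 expr0.
Qed.

(** * Chord diagrams as fixed-point-free involutions *)

Definition chords_of (N : nat) (s : {perm 'I_N}) : {set {set 'I_N}} :=
  [set [set i; s i]%SET | i in [set: 'I_N]%SET]%SET.

Definition fpf_inv (N : nat) (s : {perm 'I_N}) : bool :=
  [forall i, s (s i) == i] && [forall i, s i != i].

Lemma fpf_invP (N : nat) (s : {perm 'I_N}) :
  reflect (involutive s /\ forall i, s i != i) (fpf_inv s).
Proof.
apply: (iffP andP) => [[/forallP H1 /forallP H2]|[H1 H2]]; split=> //.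
- by move=> i; apply/eqP.
- by apply/forallP => i; apply/eqP.
- by apply/forallP.
Qed.

Lemma matching_upto_full (N : nat) (s : {perm 'I_N}) :
  matching_upto N s && (#|free_pts N s| == 0%N) = fpf_inv s.
Proof.
apply/andP/fpf_invP => [[/matching_uptoP[si _] /eqP/cards0_eq H]|[si sf]].
  split=> // i; apply/negP => sii.
  by have := finset.in_set0 i; rewrite -H inE ltn_ord sii.
split; first by apply/matching_uptoP; split=> // i; rewrite leqNgt ltn_ord.
by apply/eqP/eqP; rewrite cards_eq0; apply/eqP/finset.setP => i;
  rewrite !inE (negbTE (sf i)) andbF.
Qed.

Lemma mem_chord (N : nat) (s : {perm 'I_N}) (x i : 'I_N) : involutive s ->
  (x \in [set i; s i]%SET) -> [set i; s i]%SET = [set x; s x]%SET.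
Proof.
move=> si; rewrite !inE => /orP[/eqP->//|/eqP->].
by rewrite si finset.setUC.
Qed.

Lemma chords_of_inj (N : nat) :
  {in [set s : {perm 'I_N} | fpf_inv s]%SET &, injective (@chords_of N)}.
Proof.
move=> s s'; rewrite !inE => /fpf_invP[si sf] /fpf_invP[si' sf'] E.
apply/permP => x.
have : [set x; s x]%SET \in chords_of s by apply/imsetP; exists x.
rewrite E => /imsetP[y _ Ey].
have xin : x \in [set y; s' y]%SET by rewrite -Ey !inE eqxx.
have sxin : s x \in [set x; s' x]%SET.
  by rewrite -(mem_chord si' xin) -Ey !inE eqxx orbT.
by move: sxin; rewrite !inE (negbTE (sf x)) => /eqP.
Qed.

Lemma chords_of_partition (N : nat) (s : {perm 'I_N}) : fpf_inv s ->
  finset.partition (chords_of s) [set: 'I_N]%SET &&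
  [forall A in chords_of s, #|A| == 2%N].
Proof.
move=> /fpf_invP[si sf]; apply/andP; split; last first.
  by apply/'forall_implyP => A /imsetP[x _ ->]; rewrite cards2 [x == _]eq_sym sf.
apply/and3P; split.
- apply/eqP/finset.setP => x; rewrite finset.in_setT; apply/bigcupP.
  by exists [set x; s x]%SET; [apply/imsetP; exists x|rewrite !inE eqxx].
- apply/finset.trivIsetP => A B /imsetP[x _ ->] /imsetP[y _ ->] nAB.
  rewrite -setI_eq0; apply/negPn/negP => /finset.set0Pn[z].
  rewrite finset.in_setI => /andP[zx zy]; move/negP: nAB; apply.
  by rewrite (mem_chord si zx) (mem_chord si zy).
- apply/negP => /imsetP[x _ /esym/eqP]; rewrite -cards_eq0 cards2.
  by case: eqP.
Qed.

(** Every point is matched with the other element of its block. *)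
Lemma partition_chords_of (N : nat) (P : {set {set 'I_N}}) :
  finset.partition P [set: 'I_N]%SET -> [forall A in P, #|A| == 2%N] ->
  exists2 s : {perm 'I_N}, fpf_inv s & P = chords_of s.
Proof.
move=> /and3P[/eqP covP trivP nP] /'forall_implyP cP.
have inP x : finset.pblock P x \in P by rewrite finset.pblock_mem // covP finset.in_setT.
have xin x : x \in finset.pblock P x by rewrite finset.mem_pblock covP finset.in_setT.
have ex x : exists y, (y != x) && (finset.pblock P x == [set x; y]%SET).
  have /cards2P[a [b [ab E]]] := cP _ (inP x).
  have := xin x; rewrite E !inE => /orP[/eqP ->|/eqP ->].
    by exists b; rewrite eq_sym ab eqxx.
  by exists a; rewrite ab finset.setUC eqxx.
pose f x := xchoose (ex x).
have fP x : f x != x /\ finset.pblock P x = [set x; f x]%SET.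
  by have /andP[h1 /eqP h2] := xchooseP (ex x).
have same x y : y \in finset.pblock P x -> finset.pblock P y = finset.pblock P x.
  by move=> h; apply: finset.def_pblock trivP (inP x) h.
have ff : involutive f.
  move=> x; have [h1 h2] := fP x.
  have fin : f x \in finset.pblock P x by rewrite h2 !inE eqxx orbT.
  have [h3 h4] := fP (f x).
  have : f (f x) \in finset.pblock P x by rewrite -(same _ _ fin) h4 !inE eqxx orbT.
  by rewrite h2 !inE (negbTE h3) orbF => /eqP.
exists (perm (inv_inj ff)).
  by apply/fpf_invP; split=> [x|x]; rewrite !permE //; case: (fP x).
apply/finset.setP => A; apply/idP/imsetP => [AP|[x _ ->]].
  have /cards2P[a [b [ab E]]] := cP _ AP.
  have aA : a \in A by rewrite E !inE eqxx.
  exists a; first by rewrite finset.in_setT.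
  by rewrite permE -(fP a).2 (finset.def_pblock trivP AP aA).
by rewrite permE -(fP x).2.
Qed.

(** Ordering the two chords of a crossing pair by their left endpoints identifies
    unordered pairs of chords with [cross_pairs]. *)
Lemma crossings_chords_of (N : nat) (s : {perm 'I_N}) : fpf_inv s ->
  crossings (chords_of s) = #|cross_pairs s|.
Proof.
move=> /fpf_invP[si sf].
have crP (a c : 'I_N) : ((a, c) \in cross_pairs s) = [&& (a < c)%N, (c < s a)%N & (s a < s c)%N].
  by rewrite inE /= (negbTE (sf c)).
have eqch (a c : 'I_N) : (a < s a)%N -> (c < s c)%N ->
    [set a; s a]%SET = [set c; s c]%SET -> a = c.
  move=> ha hc E; have : a \in [set c; s c]%SET by rewrite -E !inE eqxx.
  rewrite !inE => /orP[/eqP//|/eqP asc].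
  by move: ha; rewrite asc si; lia.
(* The first chord of a crossing is the one with the smaller left endpoint. *)
pose F (p : 'I_N * 'I_N) := [set [set p.1; s p.1]; [set p.2; s p.2]]%SET.
have Finj : {in cross_pairs s &, injective F}.
  move=> [a c] [a' c']; rewrite !crP => /and3P[h1 h2 h3] /and3P[h1' h2' h3'] E.
  rewrite /F /= in E.
  have ha : (a < s a)%N by lia. have hc : (c < s c)%N by lia.
  have ha' : (a' < s a')%N by lia. have hc' : (c' < s c')%N by lia.
  have i1 : [set a; s a]%SET \in [set [set a'; s a']; [set c'; s c']]%SET.
    by rewrite -E !inE eqxx.
  have i2 : [set c; s c]%SET \in [set [set a'; s a']; [set c'; s c']]%SET.
    by rewrite -E !inE eqxx orbT.
  have i3 : [set a'; s a']%SET \in [set [set a; s a]; [set c; s c]]%SET.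
    by rewrite E !inE eqxx.
  have eqb (b d : 'I_N) : (b < s b)%N -> (d < s d)%N ->
      ([set b; s b]%SET == [set d; s d]%SET) = (b == d).
    by move=> hb hd; apply/eqP/eqP => [/eqch->|->].
  move: i1 i2 i3; rewrite !inE !eqb // -!val_eqE /= => i1 i2 i3.
  by have [/val_inj -> /val_inj ->] : a = a' :> nat /\ c = c' :> nat by lia.
rewrite /crossings -(card_in_imset Finj); apply: eq_card => X.
apply/imset2P/imsetP.
- move=> [A B /imsetP[x _ ->]]; rewrite inE => /andP[/imsetP[y _ ->]].
  move=> /existsP[a /existsP[b /existsP[c /existsP[d]]]].
  move=> /and5P[/eqP Ea /eqP Ec ab cd H] ->.
  have sab : b = s a.
    have : a \in [set x; s x]%SET by rewrite Ea !inE eqxx.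
    move=> /(mem_chord si) Ex; have : b \in [set a; s a]%SET.
      by rewrite -Ex Ea !inE eqxx orbT.
    by rewrite !inE => /orP[/eqP ba|/eqP//]; move: ab; rewrite ba ltnn.
  have scd : d = s c.
    have : c \in [set y; s y]%SET by rewrite Ec !inE eqxx.
    move=> /(mem_chord si) Ex; have : d \in [set c; s c]%SET.
      by rewrite -Ex Ec !inE eqxx orbT.
    by rewrite !inE => /orP[/eqP ba|/eqP//]; move: cd; rewrite ba ltnn.
  subst b d; rewrite Ea Ec; case/orP: H => H.
    by exists (a, c); rewrite ?crP.
  by exists (c, a); rewrite ?crP // /F /= finset.setUC.
- move=> [[a c]]; rewrite crP => H ->.
  exists [set a; s a]%SET [set c; s c]%SET => //.
    by apply/imsetP; exists a.
  rewrite inE; apply/andP; split; first by apply/imsetP; exists c.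
  apply/existsP; exists a; apply/existsP; exists (s a).
  apply/existsP; exists c; apply/existsP; exists (s c).
  by rewrite !eqxx /= H /=; case/and3P: H => *; rewrite andbT; apply/andP; split; lia.
Qed.

Lemma chord_diagram_gf (S : comNzRingType) (x : S) (n : nat) :
  \sum_(P | chord_diagram (n := n) P) x ^+ crossings P =
  match_gf x n.*2 n.*2 0.
Proof.
transitivity (\sum_(P in (@chords_of n.*2 @: [set s | fpf_inv s])%SET) x ^+ crossings P).
  apply: eq_bigl => P; apply/idP/imsetP => [/andP[h1 h2]|[s]].
    by have [s h ->] := partition_chords_of h1 h2; exists s; rewrite ?inE.
  by rewrite inE => h ->; apply: chords_of_partition.
rewrite big_imset /=; last exact: chords_of_inj.
apply: eq_big => [s|s]; first by rewrite inE matching_upto_full.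
by rewrite inE => h; rewrite crossings_chords_of.
Qed.

Definition T_poly (R : comNzRingType) (n : nat) : {poly R} :=
  \sum_(P | chord_diagram (n := n) P) 'X^(crossings P).

Lemma coef_T_poly (R : comNzRingType) (n m : nat) :
  (T_poly R n)`_m = (T_num n m)%:R.
Proof.
rewrite /T_poly coef_sum /T_num.
under eq_bigr do rewrite coefXn.
rewrite -natr_sum -sum1_card; congr (_%:R).
rewrite [RHS](eq_bigl (fun P => chord_diagram P && (m == crossings P))); last first.
  by move=> P; rewrite inE [m == _]eq_sym.
by rewrite [RHS]big_mkcondr; apply: eq_bigr => P _; case: eqP.
Qed.

(** * Powers of the Catalan series *)

(** The coefficient of z^j in Cat(z)^r.  The recursion reads off
    Cat^r = 1 + z (Cat^2 + ... + Cat^(r+1)), a consequence of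
    Cat = 1 + z Cat^2. *)
Fixpoint cat_pow (j r : nat) : nat :=
  if j is j'.+1 then (\sum_(i < r) cat_pow j' i.+2)%N else 1%N.

Lemma cat_pow0 r : cat_pow 0 r = 1%N. Proof. by []. Qed.

Lemma cat_powS0 j : cat_pow j.+1 0 = 0%N.
Proof. by rewrite /= big_ord0. Qed.

Lemma cat_powSS j r : cat_pow j.+1 r.+1 = (cat_pow j.+1 r + cat_pow j r.+2)%N.
Proof. by rewrite /= big_ord_recr. Qed.

(** Cat^r Cat^s = Cat^(r+s): both sides obey the same recursion in n and r. *)
Lemma cat_pow_conv n r s :
  (\sum_(i < n.+1) cat_pow i r * cat_pow (n - i) s)%N = cat_pow n (r + s).
Proof.
elim: n r => [|n IHn] r; first by rewrite big_ord_recl big_ord0.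
elim: r => [|r IHr].
  rewrite big_ord_recl cat_pow0 mul1n subn0 [X in (_ + X)%N]big1 ?addn0 // => i _.
  by rewrite cat_powS0 mul0n.
rewrite addSn cat_powSS -IHr -!addSn -IHn.
rewrite big_ord_recl [in RHS]big_ord_recl !cat_pow0 -addnA; congr (_ + _)%N.
rewrite -big_split; apply: eq_bigr => i _.
by rewrite lift0 cat_powSS mulnDl subSS.
Qed.

(** Lagrange's formula [z^j] Cat^(r+1) = (r+1) (2j+r)! / (j! (j+r+1)!),
    cleared of denominators. *)
Lemma cat_pow_fact j r : (cat_pow j r.+1 * (j`! * (j + r.+1)`!) = r.+1 * (j.*2 + r)`!)%N.
Proof.
elim: j r => [|j IHj] r; first by rewrite cat_pow0 !mul1n factS.
have step q : (cat_pow j.+1 q * (j.+1`! * (j.+1 + q)`!) = q * (j.*2.+1 + q)`!)%N ->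
    (cat_pow j.+1 q.+1 * (j.+1`! * (j.+1 + q.+1)`!) = q.+1 * (j.*2.+1 + q.+1)`!)%N.
  move=> IHq; rewrite cat_powSS mulnDl.
  have -> : (cat_pow j.+1 q * (j.+1`! * (j.+1 + q.+1)`!) =
     (cat_pow j.+1 q * (j.+1`! * (j.+1 + q)`!)) * (j + q).+2)%N.
    by rewrite addnS [(_ + _).+1`!]factS; ring.
  have -> : (cat_pow j q.+2 * (j.+1`! * (j.+1 + q.+1)`!) =
     (cat_pow j q.+2 * (j`! * (j + q.+2)`!)) * j.+1)%N.
    by rewrite addSnnS factS; ring.
  rewrite IHq IHj !addnS !addSn !factS -!addnn; ring.
have H q : (cat_pow j.+1 q * (j.+1`! * (j.+1 + q)`!) = q * (j.*2.+1 + q)`!)%N.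
  by elim: q => [|q /step//]; rewrite cat_powS0 !mul0n.
by rewrite H doubleS !addSn addnS.
Qed.

(** * The Touchard-Riordan formula *)

Definition tri (k : nat) : nat := ((k * k.+1)./2)%N.

Arguments tri : simpl never.

Lemma tri0 : tri 0 = 0%N. Proof. by []. Qed.

Lemma triS k : tri k.+1 = (tri k + k.+1)%N.
Proof.
rewrite /tri; have -> : (k.+1 * k.+2 = k * k.+1 + k.+1.*2)%N by rewrite -mul2n; ring.
by rewrite halfD odd_double andbF add0n doubleK.
Qed.

Section TouchardRiordan.
Variables (S : comNzRingType) (x : S).

(** The Gaussian binomial coefficient of h - 1 + j over j.  The shift by one
    gives the recurrence below a boundary at h = 0 without exceptions. *)
Fixpoint qbin_diag (h j : nat) : S :=
  match h with
  | 0 => (j == 0%N)%:R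
  | h'.+1 => (fix aux j := if j is j'.+1 then aux j' + x ^+ j * qbin_diag h' j else 1) j
  end.

Lemma qbin_diag0 j : qbin_diag 0 j = (j == 0%N)%:R. Proof. by []. Qed.
Lemma qbin_diag_0 h : qbin_diag h 0 = 1. Proof. by case: h. Qed.
Lemma qbin_diagSS h j : qbin_diag h.+1 j.+1 = qbin_diag h.+1 j + x ^+ j.+1 * qbin_diag h j.+1.
Proof. by []. Qed.
Lemma qbin_diag1 j : qbin_diag 1 j = 1.
Proof. by elim: j => // j IH; rewrite qbin_diagSS IH qbin_diag0 mulr0 addr0. Qed.

(** Both sides are the Gaussian binomial of h - 1 + j over j, times
    1 - x^(h+j). *)
Lemma qbin_diag_sym h j : (1 - x ^+ h) * qbin_diag h.+1 j = (1 - x ^+ j.+1) * qbin_diag h j.+1.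
Proof.
elim: h j => [|h IHh] j; first by rewrite qbin_diag0 expr0 subrr mul0r mulr0.
have -> : (1 - x ^+ j.+1) * qbin_diag h.+1 j.+1 = (1 - x ^+ (h + j.+1)) * qbin_diag h.+1 j.
  rewrite qbin_diagSS mulrDr mulrCA -IHh exprD; ring.
elim: j => [|j IHj]; first by rewrite !qbin_diag_0 addn1.
have E : (1 - x ^+ j.+1) * qbin_diag h.+1 j.+1 = (1 - x ^+ (h + j.+1)) * qbin_diag h.+1 j.
  rewrite qbin_diagSS mulrDr mulrCA -IHh exprD; ring.
rewrite (qbin_diagSS h.+1) mulrDr IHj -E mulrCA !exprD !exprS; ring.
Qed.

Definition tr_term (h j : nat) : S := (-1) ^+ j * x ^+ tri j * qbin_diag h j.

(** The closed form of (1 - x)^i times the weighted count of partial matchings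
    of h - 1 + 2i points with h - 1 of them unmatched. *)
Definition tr_sum (i h : nat) : S :=
  \sum_(j < i.+1) (cat_pow (i - j) (h + j.*2))%:R * tr_term h j.

Lemma tr_sumS i h : tr_sum i.+1 h = (cat_pow i.+1 h)%:R +
  \sum_(j < i.+1) (cat_pow (i - j) (h + j.*2).+2)%:R * tr_term h j.+1.
Proof.
rewrite /tr_sum big_ord_recl; congr (_ + _).
  by rewrite subn0 addn0 /tr_term qbin_diag_0 !mulr1.
by apply: eq_bigr => j _; rewrite lift0 subSS doubleS !addnS.
Qed.

(** The regrouping of terms behind [tr_sum_rec]: each F j splits into a term
    of index j and one of index j + 1. *)
Lemma sum_split_shift (i : nat) (F G H : nat -> S) :
  (forall j, (j < i)%N -> F j = G j + H j.+1) -> F i = G i ->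
  H 0%N + \sum_(j < i.+1) F j = \sum_(j < i.+1) G j + \sum_(j < i.+1) H j.
Proof.
move=> FGH FG; rewrite big_ord_recr FG [in RHS]big_ord_recr [X in _ + X = _]addrC.
rewrite [X in _ = _ + X]big_ord_recl /= [in LHS](eq_bigr (fun j : 'I_i => G j + H j.+1)).
  by rewrite big_split /=; ring.
by move=> j _; rewrite FGH.
Qed.

(** After splitting [cat_pow] by its recursion, the coefficients of each
    [cat_pow] agree by the Pascal rule and [qbin_diag_sym]. *)
Lemma tr_sum_rec i h :
  tr_sum i.+1 h.+1 = tr_sum i.+1 h + (1 - x ^+ h.+1) * tr_sum i h.+2.
Proof.
rewrite !tr_sumS cat_powSS natrD -!addrA; congr (_ + _).
have -> : (cat_pow i h.+2)%:R = (cat_pow (i - 0) (h.+2 + 0.*2))%:R * tr_term h.+1 0.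
  by rewrite subn0 addn0 /tr_term qbin_diag_0 !mulr1.
rewrite (@sum_split_shift i (fun j => (cat_pow (i - j) (h.+1 + j.*2).+2)%:R * tr_term h.+1 j.+1)
  (fun j => (cat_pow (i - j) (h + j.*2).+2)%:R * tr_term h.+1 j.+1)
  (fun j => (cat_pow (i - j) (h.+2 + j.*2))%:R * tr_term h.+1 j)) /=; last 2 first.
- move=> j ji; rewrite (_ : (i - j)%N = (i - j.+1).+1)%N; last by rewrite -subSn.
  by rewrite addSn cat_powSS natrD mulrDl doubleS !addSn !addnS.
- by rewrite subnn !cat_pow0.
rewrite mulr_sumr -!big_split; apply: eq_bigr => j _ /=.
rewrite !addSn [RHS](_ : _ = (cat_pow (i - j) (h + j.*2).+2)%:R *
  (tr_term h j.+1 + (1 - x ^+ h.+1) * tr_term h.+2 j)); last by ring.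
rewrite -mulrDr; congr (_ * _).
rewrite /tr_term mulrCA qbin_diag_sym qbin_diagSS triS exprD exprS; ring.
Qed.

Lemma tr_sum_0 i : tr_sum i.+1 0 = 0.
Proof.
rewrite /tr_sum big_ord_recl /= big_ord0 mul0r add0r big1 // => j _.
by rewrite /tr_term qbin_diag0 !mulr0.
Qed.

Lemma tr_sum0 h : tr_sum 0 h = 1.
Proof.
by rewrite /tr_sum big_ord_recl big_ord0 /tr_term qbin_diag_0 !mulr1 addr0.
Qed.

Lemma match_gf_vanish (N k h : nat) : (k <= N)%N -> (k < h)%N -> match_gf x N k h = 0.
Proof.
elim: k h => [|k IH] h kN kh; first by rewrite match_gf0; case: h kh.
have -> := match_gfS x (Ordinal kN) h; rewrite /=.
by case: h kh => // h kh; rewrite !IH ?mulr0 ?addr0 //; lia.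
Qed.

Lemma match_gf_closed (N i h : nat) : (h + i.*2 <= N)%N ->
  (1 - x) ^+ i * match_gf x N (h + i.*2) h = tr_sum i h.+1.
Proof.
have [k] := ubnP (h + i.*2); elim: k i h => // k IH i h; rewrite ltnS => hk hN.
case E : (h + i.*2)%N => [|k'].
  have -> : h = 0%N by lia. have -> : i = 0%N by lia.
  by rewrite match_gf0 tr_sum0 mulr1.
have kN : (k' < N)%N by rewrite -E.
have -> := match_gfS x (Ordinal kN) h; rewrite /=.
case: i hk hN E => [|i] hk hN E.
  rewrite match_gf_vanish ?mulr0 ?addr0; [|lia..].
  case: h hk hN E => [|h] hk hN E; first by [].
  have -> : k' = (h + 0.*2)%N by lia.
  by rewrite IH; [rewrite !tr_sum0|lia..].
have E1 : k' = (h.+1 + i.*2)%N by lia.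
rewrite tr_sum_rec mulrDr.
rewrite exprS -mulrA [in X in _ + X]mulrCA [in X in _ + X]mulrA [in X in _ + X]E1.
congr (_ + _).
  case: h hk hN E {E1} => [|h] hk hN E; first by rewrite tr_sum_0 !mulr0.
  have -> : k' = (h + i.+1.*2)%N by lia.
  by rewrite mulrA -exprS IH //; lia.
have -> : 1 - x ^+ h.+1 = (1 - x) * \sum_(t < h.+1) x ^+ t.
  by rewrite -opprB subrX1 -mulNr opprB.
rewrite -(IH i h.+1); [ring|lia..].
Qed.

Lemma touchard_riordan n :
  (1 - x) ^+ n * match_gf x n.*2 n.*2 0 =
  \sum_(j < n.+1) (cat_pow (n - j) j.*2.+1)%:R * ((-1) ^+ j * x ^+ tri j).
Proof.
have -> := @match_gf_closed n.*2 n 0 (leqnn _).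
by apply: eq_bigr => j _; rewrite /tr_term qbin_diag1 mulr1 add1n.
Qed.

End TouchardRiordan.

(** * Powers of the generating function *)

Definition conv (R : pzSemiRingType) (u v : nat -> R) (n : nat) : R :=
  \sum_(i < n.+1) u i * v (n - i)%N.

Definition cpow (R : pzSemiRingType) (u : nat -> R) (l : nat) : nat -> R :=
  iter l (conv u) (fun n => (n == 0%N)%:R).

Lemma fps2_expE (R : comNzRingType) (l m n : nat) :
  fps2_exp (T_fps R) l m n = (cpow (T_poly R) l n)`_m.
Proof.
elim: l m n => [|l IH] m n.
  by rewrite /= /fps2_one /cpow /= -[(n == 0)%:R]/((n == 0%N)%:R) -polyC_natr coefC; case: m => [|m]; case: n.
rewrite /fps2_exp /cpow !iterS -/(cpow _ _) -/(fps2_exp _ _) /fps2_mul /conv.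
rewrite coef_sum exchange_big; apply: eq_bigr => j _ /=.
rewrite coefM; apply: eq_bigr => i _.
by rewrite IH /T_fps coef_T_poly.
Qed.

(** Substituting c y for y commutes with taking powers. *)
Lemma cpow_scale (R : comNzRingType) (c : R) (u : nat -> R) (l n : nat) :
  c ^+ n * cpow u l n = cpow (fun n => c ^+ n * u n) l n.
Proof.
elim: l n => [|l IH] n; first by rewrite /cpow /=; case: n => [|n]; rewrite ?mulr0 ?mulr1.
rewrite /cpow !iterS -!/(cpow _ _) /conv mulr_sumr; apply: eq_bigr => i _.
rewrite -IH mulrACA; congr (_ * _).
by rewrite -exprD subnKC // -ltnS.
Qed.

Lemma eq_cpow (R : comNzRingType) (u v : nat -> R) : u =1 v -> cpow u =2 cpow v.
Proof.
move=> uv l; elim: l => // l IH n.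
rewrite /cpow !iterS -!/(cpow _ _) /conv; apply: eq_bigr => i _.
by rewrite uv -!/(cpow _ _ _) IH.
Qed.

(** The sum of phi (k_1 + ... + k_l) (tri k_1 + ... + tri k_l) over all
    k_1, ..., k_l < N.  Only the two totals matter for the summands here, which
    is why the tuple itself is not kept. *)
Fixpoint boxsum (V : nmodType) (N l : nat) (phi : nat -> nat -> V) : V :=
  if l is l'.+1 then
    \sum_(k < N) boxsum N l' (fun K J => phi (k + K)%N (tri k + J)%N)
  else phi 0%N 0%N.

Lemma eq_boxsum (V : nmodType) (N l : nat) (phi psi : nat -> nat -> V) :
  phi =2 psi -> boxsum N l phi = boxsum N l psi.
Proof.
elim: l phi psi => [|l IH] phi psi E /=; first exact: E.
by apply: eq_bigr => k _; apply: IH => K J; apply: E.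
Qed.

Lemma boxsum_sum (V : nmodType) (I : Type) (r : seq I) (P : pred I) (N l : nat)
    (phi : I -> nat -> nat -> V) :
  \sum_(i <- r | P i) boxsum N l (phi i) =
  boxsum N l (fun K J => \sum_(i <- r | P i) phi i K J).
Proof.
elim: l phi => [|l IH] phi //=.
by rewrite exchange_big; apply: eq_bigr => k _; rewrite IH.
Qed.

Lemma boxsum_raddf (V W : nmodType) (f : {additive V -> W}) (N l : nat)
    (phi : nat -> nat -> V) :
  f (boxsum N l phi) = boxsum N l (fun K J => f (phi K J)).
Proof.
elim: l phi => [|l IH] phi //=.
by rewrite raddf_sum; apply: eq_bigr => k _; rewrite IH.
Qed.

Lemma boxsumMl (R : pzRingType) (c : R) (N l : nat) (phi : nat -> nat -> R) :
  c * boxsum N l phi = boxsum N l (fun K J => c * phi K J).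
Proof.
elim: l phi => [|l IH] phi //=.
by rewrite mulr_sumr; apply: eq_bigr => k _; rewrite IH.
Qed.

(** The coefficient of z^n in z^K Cat(z)^(2K+l). *)
Definition ballot (l K n : nat) : nat :=
  if (K <= n)%N then cat_pow (n - K) (K.*2 + l) else 0%N.

Lemma conv_shift (f g : nat -> nat) (k n : nat) :
  (\sum_(i < n.+1) (if (k <= i)%N then f (i - k)%N else 0%N) * g (n - i)%N =
   if (k <= n)%N then \sum_(i < (n - k).+1) f i * g (n - k - i)%N else 0)%N.
Proof.
elim: k n => [|k IH] n; first by rewrite subn0; apply: eq_bigr => i _; rewrite subn0.
rewrite big_ord_recl ltn0 mul0n add0n; case: n => [|n]; first by rewrite big_ord0.
by rewrite ltnS subSS -IH; apply: eq_bigr => i _; rewrite lift0 ltnS !subSS.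
Qed.

Lemma ballot_conv l k K n :
  (\sum_(i < n.+1) ballot 1 k i * ballot l K (n - i) = ballot l.+1 (k + K) n)%N.
Proof.
rewrite /ballot (conv_shift (fun i => cat_pow i (k.*2 + 1))
  (fun i => if (K <= i)%N then cat_pow (i - K) (K.*2 + l) else 0%N)).
case: leqP => kn; last by rewrite leqNgt (leq_trans kn) ?leq_addr.
rewrite (reindex_inj rev_ord_inj) /=.
under eq_bigr => i _ do rewrite subSS (subKn (ltn_ord i : (i <= n - k)%N)) mulnC.
rewrite (conv_shift (fun i => cat_pow i (K.*2 + l)) (fun i => cat_pow i (k.*2 + 1))).
rewrite -[(K <= n - k)%N](leq_add2l k) subnKC //; case: leqP => // kKn.
rewrite cat_pow_conv -subnDA; congr cat_pow; rewrite doubleD; lia.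
Qed.

(** Any N > n gives the same value, since the summands with K > n vanish. *)
Lemma cpow_ballot (R : comNzRingType) (x : R) (N l n : nat) : (n < N)%N ->
  cpow (fun n => \sum_(j < n.+1) (cat_pow (n - j) j.*2.+1)%:R * ((-1) ^+ j * x ^+ tri j)) l n =
  boxsum N l (fun K J => (-1) ^+ K * x ^+ J * (ballot l K n)%:R).
Proof.
elim: l n => [|l IH] n nN.
  by rewrite /cpow /= /ballot subn0 !mul1r; case: n {nN} => //= n; rewrite big_ord0.
rewrite /cpow iterS -/(cpow _ _) /conv /=.
have E (i : 'I_n.+1) :
    \sum_(j < i.+1) (cat_pow (i - j) j.*2.+1)%:R * ((-1) ^+ j * x ^+ tri j) =
    \sum_(j < N) (ballot 1 j i)%:R * ((-1) ^+ j * x ^+ tri j).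
  rewrite [RHS](bigID (fun j : 'I_N => (j < i.+1)%N)) /= [X in _ = _ + X]big1 ?addr0.
    have iN : (i.+1 <= N)%N by rewrite (leq_trans _ nN).
    rewrite (big_ord_widen N (fun j => (cat_pow (i - j) j.*2.+1)%:R * ((-1) ^+ j * x ^+ tri j)) iN).
    by apply: eq_bigr => j; rewrite ltnS /ballot => ->; rewrite addn1.
  by move=> j; rewrite ltnS /ballot => /negbTE ->; rewrite mul0r.
under eq_bigr => i _.
  rewrite E -/(cpow _ _ _) IH; last by rewrite (leq_ltn_trans (leq_subr _ _)).
  rewrite mulr_suml; over.
rewrite exchange_big; apply: eq_bigr => k _ /=.
under eq_bigr do rewrite boxsumMl.
rewrite boxsum_sum; apply: eq_boxsum => K J.
rewrite -ballot_conv natr_sum mulr_sumr; apply: eq_bigr => i _.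
by rewrite natrM !exprD; ring.
Qed.

(** The coefficient of x^j in (1 - x)^(-n). *)
Definition negbin (n j : nat) : nat := 'C(n + j - 1, j).

Lemma negbin0 j : negbin 0 j = (j == 0%N).
Proof. by case: j => // j; rewrite /negbin bin_small // add0n subn1. Qed.

Lemma negbin_0 n : negbin n 0 = 1%N. Proof. exact: bin0. Qed.

Lemma negbinSS n j : negbin n.+1 j.+1 = (negbin n.+1 j + negbin n j.+1)%N.
Proof.
by rewrite /negbin !addSn !addnS !subn1 /= binS addnC.
Qed.

(** Division by (1 - x)^n without power series: divide by 1 - x, that is take
    partial sums of coefficients, n times. *)
Lemma coef_div_exp1BX (R : comNzRingType) (n : nat) (p g : {poly R}) (m : nat) :
  (1 - 'X) ^+ n * p = g ->
  p`_m = \sum_(j < m.+1) g`_j * (negbin n (m - j))%:R.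
Proof.
elim: n p m => [|n IHn] p m E.
  rewrite -E mul1r big_ord_recr /= subnn negbin0 mulr1 big1 ?add0r // => j _.
  by rewrite negbin0 subn_eq0 leqNgt ltn_ord mulr0.
have E' : (1 - 'X) ^+ n * ((1 - 'X) * p) = g by rewrite mulrA -exprSr.
elim: m => [|m IHm].
  have := IHn _ 0%N E'; rewrite !big_ord_recl !big_ord0 !addr0 !negbin_0 => <-.
  by rewrite mulrBl mul1r coefB coefXM subr0.
have -> : p`_m.+1 = p`_m + ((1 - 'X) * p)`_m.+1.
  by rewrite mulrBl mul1r coefB coefXM /= addrC subrK.
rewrite IHm (IHn _ _ E') [X in _ + X]big_ord_recr [in RHS]big_ord_recr /= subnn !negbin_0 addrA.
congr (_ + _); rewrite -big_split; apply: eq_bigr => j _ /=.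
by rewrite subSn -1?ltnS // negbinSS natrD mulrDr.
Qed.

Lemma fps2_exp_boxsum (R : comNzRingType) (N l m n : nat) : (n < N)%N ->
  fps2_exp (T_fps R) l m n =
  boxsum N l (fun K J => (-1) ^+ K * (ballot l K n)%:R *
    (if (J <= m)%N then negbin n (m - J) else 0%N)%:R).
Proof.
move=> nN; rewrite fps2_expE.
have E : (1 - 'X) ^+ n * cpow (T_poly R) l n =
    boxsum N l (fun K J => (-1) ^+ K * 'X^J * (ballot l K n)%:R).
  rewrite cpow_scale -cpow_ballot //; apply: eq_cpow => k.
  by rewrite -touchard_riordan -chord_diagram_gf.
rewrite (coef_div_exp1BX m E).
have coefg j : (boxsum N l (fun K J => (-1) ^+ K * 'X^J * (ballot l K n)%:R))`_j =
    boxsum N l (fun K J => (-1) ^+ K * (ballot l K n)%:R * (j == J)%:R) :> R.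
  rewrite -[LHS]/(coefp j _) boxsum_raddf; apply: eq_boxsum => K J /=.
  rewrite -polyC_natr -signr_odd -polyC1 -polyCN -polyC_exp signr_odd.
  by rewrite coefMC coefCM coefXn mulrAC.
under eq_bigr => j _ do rewrite coefg mulrC boxsumMl.
rewrite boxsum_sum; apply: eq_boxsum => K J.
case: leqP => Jm; last first.
  rewrite mulr0 big1 // => j _; rewrite [(_ == J)]ltn_eqF ?mulr0 //.
  by rewrite (leq_ltn_trans _ Jm) // -ltnS.
rewrite (bigD1 (Ordinal (Jm : (J < m.+1)%N))) //= eqxx mulr1 big1 ?addr0 1?mulrC // => j.
by rewrite -val_eqE /= => /negbTE ->; rewrite !mulr0.
Qed.

(** * Comparing ballot numbers with Catalan numbers *)

(** Weierstrass' product inequality. *)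
Lemma prod1B_ge (R : realFieldType) (I : Type) (r : seq I) (a : I -> R) :
  (forall i, 0 <= a i <= 1) ->
  1 - \sum_(i <- r) a i <= \prod_(i <- r) (1 - a i) <= 1.
Proof.
move=> ha; elim: r => [|i r /andP[IH1 IH2]]; first by rewrite !big_nil subr0 lexx.
rewrite !big_cons; have /andP[h1 h2] := ha i.
have P0 : 0 <= \prod_(i <- r) (1 - a i) by apply: prodr_ge0 => j _; have := ha j; lra.
apply/andP; split; last by nra.
by nra.
Qed.

Section CatalanRatio.
Variable R : realType.

Lemma natr_fact_neq0 n : (n`!%:R : R) != 0.
Proof. by rewrite pnatr_eq0 -lt0n fact_gt0. Qed.

Lemma catalan_fact n : catalan R n * (n`!%:R * n.+1`!%:R) = n.*2`!%:R.
Proof.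
have h : (n <= n.*2)%N by rewrite -addnn leq_addr.
rewrite /catalan -(bin_fact h) -[in (_ - _)%N]addnn addnK factS !natrM.
field; apply/eqP => h0; have := ler0n R n; lra.
Qed.

Lemma catalan_gt0 n : 0 < catalan R n.
Proof.
rewrite /catalan mulr_gt0 ?invr_gt0 ?ltr0n // bin_gt0 -addnn; exact: leq_addr.
Qed.

Let e n i : R := (i.+1 + 2)%:R / (2 * (n + i + 2)%:R).
Let v l n i : R := (i.*2 + l.+1)%:R / (n + l + i).+1%:R.

(** (2n+l)! (n+1)! / ((n+l+1)! (2n)!) as a product of l factors close to 2;
    the i-th one is (2n+i+1)/(n+i+2) = 2 (1 - e n i). *)
Lemma fact_quotient_double n l :
  (\prod_(i <- iota 0 l) (2 * (1 - e n i))) * ((n + l.+1)`!%:R * n.*2`!%:R) =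
  (n.*2 + l)`!%:R * n.+1`!%:R.
Proof.
elim: l => [|l IH]; first by rewrite big_nil mul1r addn0 addn1 mulrC.
rewrite -addn1 iotaD big_cat big_seq1 /= add0n addn1.
have -> : ((n + l.+2)`!%:R : R) = (n + l + 2)%:R * (n + l.+1)`!%:R.
  by rewrite -natrM addnS factS !addnS addn0.
have -> : ((n.*2 + l.+1)`!%:R : R) = (n.*2 + l.+1)%:R * (n.*2 + l)`!%:R.
  by rewrite -natrM addnS factS.
have E : 2 * (1 - e n l) * (n + l + 2)%:R = (n.*2 + l.+1)%:R.
  rewrite /e -addnn !natrD -[l.+1]addn1 natrD; field.
  by apply/eqP => h0; have := ler0n R n; have := ler0n R l; lra.
set A := \prod_(i <- _) _ in IH *.
transitivity (A * ((n + l.+1)`!%:R * n.*2`!%:R) * (2 * (1 - e n l) * (n + l + 2)%:R)).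
  by ring.
by rewrite IH E; ring.
Qed.

(** n! (n+l)! / ((n-K)! (n+l+K)!) as a product of K factors close to 1; the
    i-th one is (n-i)/(n+l+i+1) = 1 - v l n i. *)
Lemma fact_quotient_centred l n K : (K <= n)%N ->
  (\prod_(i <- iota 0 K) (1 - v l n i)) * ((n - K)`!%:R * (n + l + K)`!%:R) =
  n`!%:R * (n + l)`!%:R.
Proof.
elim: K => [|K IH] Kn; first by rewrite big_nil mul1r subn0 addn0.
rewrite -addn1 iotaD big_cat big_seq1 /= add0n addn1 -IH ?(ltnW Kn) //.
have -> : ((n + l + K.+1)`!%:R : R) = (n + l + K).+1%:R * (n + l + K)`!%:R.
  by rewrite -natrM addnS factS.
have -> : ((n - K)`!%:R : R) = (n - K)%:R * (n - K.+1)`!%:R.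
  by rewrite -natrM (_ : (n - K)%N = (n - K.+1).+1)%N ?factS // -subSn.
have E : (1 - v l n K) * (n + l + K).+1%:R = (n - K)%:R.
  rewrite /v natrB 1?ltnW // -[(n + l + K).+1]addn1 -[l.+1]addn1 -muln2 !natrD natrM; field.
  by apply/eqP => h0; have := ler0n R n; have := ler0n R l; have := ler0n R K; lra.
by rewrite -E; ring.
Qed.

Lemma ballot_catalan l n K : (K <= n)%N ->
  (ballot l.+1 K n)%:R / catalan R n =
  (K.*2 + l.+1)%:R * (\prod_(i <- iota 0 l) (2 * (1 - e n i))) *
  \prod_(i <- iota 0 K) (1 - v l.+1 n i).
Proof.
move=> Kn; have := cat_pow_fact (n - K) (K.*2 + l).
have -> : (n - K + (K.*2 + l).+1 = n + l.+1 + K)%N by rewrite -addnn; lia.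
have -> : ((n - K).*2 + (K.*2 + l) = n.*2 + l)%N by lia.
move=> /(congr1 (fun i => i%:R : R)); rewrite !natrM => Eb.
have EU := fact_quotient_double n l; have EV := fact_quotient_centred l.+1 Kn; have EC := catalan_fact n.
rewrite /ballot Kn addnS; have C0 := lt0r_neq0 (catalan_gt0 n).
apply: (mulIf C0); rewrite mulfVK //.
have H : (n - K)`!%:R * (n + l.+1 + K)`!%:R * (n`!%:R * n.+1`!%:R) * (n + l.+1)`!%:R != 0 :> R.
  by rewrite !mulf_neq0 // natr_fact_neq0.
apply: (mulIf H).
set b := (cat_pow _ _)%:R in Eb *.
set U := \prod_(i <- _) _ in EU *; set V := \prod_(i <- _) _ in EV *.
transitivity (b * ((n - K)`!%:R * (n + l.+1 + K)`!%:R) * (n`!%:R * n.+1`!%:R) * (n + l.+1)`!%:R).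
  by ring.
rewrite Eb.
transitivity ((K.*2 + l).+1%:R * (U * ((n + l.+1)`!%:R * (catalan R n * (n`!%:R * n.+1`!%:R)))) *
  (V * ((n - K)`!%:R * (n + l.+1 + K)`!%:R))); last by ring.
by rewrite EC EU EV; ring.
Qed.

(** The factors of [ballot_catalan] differ from their limits by at most
    (l+1)/n and (2K+l+2)/n relatively, and there are l + K of them.  For
    K > n the ballot number is 0 and the right-hand side exceeds the main
    term. *)
Lemma ballot_catalan_err l n K : (0 < n)%N ->
  `|(ballot l.+1 K n)%:R / catalan R n - 2 ^+ l * (K.*2 + l.+1)%:R| <=
  2 ^+ l * (K.*2 + l.+1)%:R * ((l.+3)%:R ^+ 2 * (1 + K%:R) ^+ 2 / n%:R).
Proof.
move=> n0; have n0R : 0 < n%:R :> R by rewrite ltr0n.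
set w := (K.*2 + l.+1)%:R; have w0 : 0 <= 2 ^+ l * w by rewrite mulr_ge0 ?exprn_ge0 ?ler0n.
have k0 := ler0n R K; have l0 := ler0n R l.
case: (leqP K n) => Kn; last first.
  rewrite /ballot leqNgt Kn /= mul0r sub0r normrN ger0_norm //.
  rewrite ler_peMr // ler_pdivlMr // mul1r.
  have : n%:R <= K%:R :> R by rewrite ler_nat ltnW.
  by rewrite -[l.+3]addn3 natrD; nra.
rewrite ballot_catalan //.
have -> : \prod_(i <- iota 0 l) (2 * (1 - e n i)) = 2 ^+ l * \prod_(i <- iota 0 l) (1 - e n i).
  by rewrite big_split /= big_const_seq count_predT size_iota iter_mulr mulr1.
set A := \prod_(i <- iota 0 l) _; set B := \prod_(i <- iota 0 K) _.
have -> : w * (2 ^+ l * A) * B - 2 ^+ l * w = - (2 ^+ l * w * (1 - A * B)) by ring.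
have /andP[A1 A2] : 1 - \sum_(i <- iota 0 l) e n i <= A <= 1.
  apply: prod1B_ge => i; rewrite /e divr_ge0 ?mulr_ge0 ?ler0n //=.
  rewrite ler_pdivrMr ?mulr_gt0 ?ltr0n ?addnS // mul1r -natrM ler_nat; lia.
have A0 : 0 <= A.
  apply: prodr_ge0 => i _; rewrite subr_ge0 /e ler_pdivrMr ?mulr_gt0 ?ltr0n ?addnS // mul1r -natrM ler_nat; lia.
have vle i : (i < K)%N -> v l.+1 n i <= 1.
  move=> iK; rewrite /v ler_pdivrMr ?ltr0n // mul1r ler_nat; lia.
have /andP[B1 B2] : 1 - \sum_(i <- iota 0 K) v l.+1 n i <= B <= 1.
  have := @prod1B_ge R _ (iota 0 K) (fun i => if (i < K)%N then v l.+1 n i else 0).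
  rewrite [X in 1 - X](eq_big_seq (v l.+1 n)); last by move=> i; rewrite mem_iota => /= ->.
  rewrite [\prod_(_ <- _) _](eq_big_seq (fun i => 1 - v l.+1 n i)); last by move=> i; rewrite mem_iota => /= ->.
  apply=> i; case: ifP => iK; rewrite ?lexx ?ler01 // vle // andbT.
  by rewrite /v divr_ge0 ?ler0n.
have B0 : 0 <= B.
  rewrite /B big_seq; apply: prodr_ge0 => i; rewrite mem_iota => /= iK.
  by rewrite subr_ge0 vle.
have SA : \sum_(i <- iota 0 l) e n i <= l%:R * l.+1%:R / n%:R.
  apply: (@le_trans _ _ (\sum_(i <- iota 0 l) (l.+1%:R / n%:R))).
    rewrite big_seq [leRHS]big_seq; apply: ler_sum => i; rewrite mem_iota => /= il.
    rewrite /e ler_pdivrMr ?mulr_gt0 ?ltr0n ?addnS // mulrAC ler_pdivlMr //.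
    rewrite -!natrM ler_nat; apply: (@leq_trans (2 * l.+1 * n)).
      by apply: leq_mul => //; clear -il; lia.
    by rewrite [(2 * _)%N]mulnC -mulnA; apply: leq_mul => //; clear -il; lia.
  by rewrite big_const_seq count_predT size_iota iter_addr addr0 -[leLHS]mulr_natl mulrA.
have SB : \sum_(i <- iota 0 K) v l.+1 n i <= K%:R * (K.*2 + l.+2)%:R / n%:R.
  apply: (@le_trans _ _ (\sum_(i <- iota 0 K) ((K.*2 + l.+2)%:R / n%:R))).
    rewrite big_seq [leRHS]big_seq; apply: ler_sum => i; rewrite mem_iota => /= il.
    rewrite /v ler_pdivrMr ?ltr0n // mulrAC ler_pdivlMr //.
    by rewrite -!natrM ler_nat; apply: leq_mul; clear -il; lia.
  by rewrite big_const_seq count_predT size_iota iter_addr addr0 -[leLHS]mulr_natl mulrA.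
rewrite normrN ger0_norm; last by rewrite mulr_ge0 // subr_ge0 mulr_ile1.
apply: ler_wpM2l => //.
apply: (@le_trans _ _ (l%:R * l.+1%:R / n%:R + K%:R * (K.*2 + l.+2)%:R / n%:R)); first by nra.
rewrite -mulrDl; apply: ler_wpM2r; first by rewrite invr_ge0 ltW.
rewrite -[l.+3]addn3 -[l.+2]addn2 -[l.+1]addn1 -muln2 !natrD natrM; nra.
Qed.

End CatalanRatio.

(** * Comparing coefficients of a negative power with powers of q *)

Section NegbinRatio.
Variable R : realType.

(** The geometric sum 1 + s + ... + s^(J-1) has J terms, all at least s^(J-1). *)
Lemma geom_weight_sharp (s : R) J : 0 <= s <= 1 ->
  J%:R * (1 - s) * s ^+ J.-1 <= 1 - s ^+ J.
Proof.
move=> /andP[s0 s1]; case: J => [|J]; first by rewrite !mul0r expr0 subrr.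
rewrite -[leRHS]opprB subrX1 -mulNr opprB.
rewrite mulrAC mulrC; apply: ler_wpM2l; first by rewrite subr_ge0.
rewrite mulr_natl -[X in _ *+ X]card_ord -sumr_const; apply: ler_sum => i _ /=.
by apply: ler_wiXn2l => //; rewrite -ltnS.
Qed.

(** A factor J costs 1/(1-s) once some of the decay s^J is given up. *)
Lemma geom_weight (s : R) J : 0 <= s <= 1 -> J%:R * (1 - s) * s ^+ J.-1 <= 1.
Proof.
move=> s01; apply: (le_trans (geom_weight_sharp J s01)).
by rewrite gerBl exprn_ge0 //; case/andP: s01.
Qed.

Variables n m : nat.
Hypothesis n0 : (0 < n)%N.

Let q : R := m%:R / (m + n)%:R.
Let p (J : nat) : R := \prod_(i < J) ((m%:R - i%:R) / ((m + n)%:R - i%:R)).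

Let a0 : 0 < n%:R :> R. Proof. by rewrite ltr0n. Qed.
Let s0 : 0 < (m + n)%:R :> R. Proof. by rewrite ltr0n addn_gt0 n0 orbT. Qed.
Let sE : (m + n)%:R = m%:R + n%:R :> R. Proof. by rewrite natrD. Qed.
Let b0 : 0 <= m%:R :> R. Proof. exact: ler0n. Qed.

Lemma saddle_ge0 : 0 <= q. Proof. by rewrite divr_ge0. Qed.
Lemma saddle_1B : 1 - q = n%:R / (m + n)%:R.
Proof. by rewrite /q sE; field; rewrite -sE lt0r_neq0. Qed.
Lemma saddle_lt1 : q < 1.
Proof. by rewrite -subr_gt0 saddle_1B divr_gt0. Qed.

Lemma falling_ratio_eq0 J : (m < J)%N -> p J = 0.
Proof.
by move=> mJ; rewrite /p (bigD1 (Ordinal mJ)) //= subrr !mul0r.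
Qed.

Lemma falling_ratioS J : p J.+1 = p J * ((m%:R - J%:R) / ((m + n)%:R - J%:R)).
Proof. by rewrite /p big_ord_recr. Qed.

Lemma falling_ratio_bounds J : 0 <= p J <= q ^+ J.
Proof.
elim: J => [|J /andP[IH1 IH2]]; first by rewrite /p big_ord0 expr0 ler01 lexx.
case: (ltnP m J) => mJ; first by rewrite falling_ratio_eq0 ?lexx ?exprn_ge0 ?saddle_ge0 // ltnW.
have Jm : J%:R <= m%:R :> R by rewrite ler_nat.
have d0 : 0 < (m + n)%:R - J%:R :> R by rewrite sE; have := a0; lra.
rewrite falling_ratioS exprSr; apply/andP; split.
  by rewrite mulr_ge0 // divr_ge0 ?subr_ge0 // ltW // -subr_gt0.
apply: ler_pM => //; first by rewrite divr_ge0 ?subr_ge0 // ltW // -subr_gt0.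
rewrite /q ler_pdivrMr // mulrAC ler_pdivlMr //.
have := ler0n R J; have := a0; rewrite sE; nra.
Qed.

(** Factor i falls short of q by at most 2 i (1-q)^2 / n as long as
    2i <= m + n, and summing over i < J gives the bound.  For larger J the
    right-hand side exceeds q^J, because then J (1-q) >= n/2 and n >= 4.  The
    exponent J - 1, instead of J, avoids a division by q. *)
Lemma falling_ratio_ge J : (4 <= n)%N ->
  q ^+ J - p J <= q ^+ J.-1 * (J%:R * (1 - q)) ^+ 2 / n%:R.
Proof.
move=> n4; have q0 := saddle_ge0; have q1 := saddle_lt1; have := a0; have j0 := ler0n R J.
set a := n%:R => A0; have A4 : 4 <= a by rewrite /a ler_nat.
case: (leqP J.*2 (m + n)) => hJ; last first.
  have h : a / 2 <= J%:R * (1 - q).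
    rewrite saddle_1B -/a mulrA ler_pdivlMr // mulrC mulrA ler_pdivrMr // mulrAC.
    apply: ler_wpM2r; first exact: ltW.
    by rewrite -natrM ler_nat; clear -hJ; lia.
  apply: (@le_trans _ _ (q ^+ J)); first by rewrite gerBl; case/andP: (falling_ratio_bounds J).
  apply: (@le_trans _ _ (q ^+ J.-1)).
    by apply: ler_wiXn2l => //; [exact: ltW|exact: leq_pred].
  rewrite -mulrA ler_peMr ?exprn_ge0 // ler_pdivlMr // mul1r.
  by rewrite expr2; nra.
have H : q ^+ J - p J <= q ^+ J.-1 * (J%:R * (J%:R - 1) * (1 - q) ^+ 2) / a.
  elim: J hJ {j0} => [|J IH] hJ; first by rewrite /p big_ord0 expr0 subrr !mul0r mulr0 mul0r.
  have {}IH := IH ltac:(lia); have := falling_ratio_bounds J; move=> /andP[pJ0 pJ1].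
  have J0 := ler0n R J.
  have hJ' : 2 * J%:R <= (m + n)%:R :> R by rewrite -natrM ler_nat; clear -hJ; lia.
  have d0 : 0 < (m + n)%:R - J%:R :> R by have := s0; lra.
  rewrite falling_ratioS /=.
  set f := (m%:R - J%:R) / _.
  have -> : q ^+ J.+1 - p J * f = q * (q ^+ J - p J) + p J * (q - f) by rewrite exprS; ring.
  have qf : q - f = J%:R * a / ((m + n)%:R * ((m + n)%:R - J%:R)).
    rewrite /q /f; move: d0 s0; rewrite sE -/a => d1 s1; field.
    by rewrite -/a !lt0r_neq0.
  have qf2 : q - f <= 2 * J%:R * (1 - q) ^+ 2 / a.
    have -> : 2 * J%:R * (1 - q) ^+ 2 / a = 2 * J%:R * a / ((m + n)%:R * (m + n)%:R).
      by rewrite saddle_1B -/a; field; rewrite -sE !lt0r_neq0.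
    rewrite qf ler_pdivrMr ?mulr_gt0 // mulrAC ler_pdivlMr ?mulr_gt0 //.
    have -> : 2 * J%:R * a * ((m + n)%:R * ((m + n)%:R - J%:R)) =
      J%:R * a * ((m + n)%:R * (2 * ((m + n)%:R - J%:R))) :> R by ring.
    apply: ler_wpM2l; first by rewrite mulr_ge0 // ltW.
    by apply: ler_wpM2l; [exact: ltW|lra].
  have X1 : p J * (q - f) <= q ^+ J * (2 * J%:R * (1 - q) ^+ 2 / a).
    apply: ler_pM => //; rewrite qf.
    by rewrite divr_ge0 ?mulr_ge0 // ltW.
  have X2 : q * (q ^+ J - p J) <= q ^+ J * (J%:R * (J%:R - 1) * (1 - q) ^+ 2) / a.
    case: J IH {hJ hJ' d0 f qf qf2 X1} pJ0 pJ1 J0 => [|J] IH pJ0 pJ1 J0.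
      by rewrite /p big_ord0 expr0 subrr mulr0 !mul0r mulr0 mul0r.
    by apply: (le_trans (ler_wpM2l q0 IH)); rewrite /= [q ^+ J.+1]exprS !mulrA.
  apply: (le_trans (lerD X2 X1)); rewrite -[J.+1]addn1 natrD le_eqVlt; apply/orP; left.
  by apply/eqP; field; rewrite lt0r_neq0.
apply: (le_trans H); apply: ler_wpM2r; first by rewrite invr_ge0 ltW.
apply: ler_wpM2l; first by rewrite exprn_ge0.
rewrite exprMn; apply: ler_wpM2r; first by rewrite sqr_ge0.
by rewrite expr2; nra.
Qed.

Lemma negbin_gt0 j : (0 < negbin n j)%N.
Proof. by rewrite /negbin bin_gt0; lia. Qed.

(** The quotient has factors (m-i)/(m+n-1-i); passing to the denominators
    m+n-i telescopes to the correction (m+n)/(m+n-J). *)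
Lemma negbin_falling_ratio J : (J <= m)%N -> (negbin n (m - J))%:R =
  (negbin n m)%:R * (p J * (m + n)%:R / ((m + n)%:R - J%:R)).
Proof.
elim: J => [|J IH] Jm.
  by rewrite /p big_ord0 subn0 subr0 mul1r divff ?mulr1 // lt0r_neq0.
have JmR : J.+1%:R <= m%:R :> R by rewrite ler_nat.
have J1 : J.+1%:R = J%:R + 1 :> R by rewrite -addn1 natrD.
have d0 : (m + n)%:R - J%:R != 0 :> R by apply: lt0r_neq0; have := a0; rewrite sE; lra.
have d1 : (m + n)%:R - J.+1%:R != 0 :> R by apply: lt0r_neq0; have := a0; rewrite sE; lra.
have {}IH := IH (ltnW Jm).
have E : ((m + n)%:R - J.+1%:R) * (negbin n (m - J.+1))%:R =
   (m%:R - J%:R) * (negbin n (m - J))%:R :> R.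
  rewrite -!natrB ?(ltnW Jm) ?(leq_trans Jm) ?leq_addr // -!natrM; congr _%:R.
  rewrite (_ : m - J = (m - J.+1).+1)%N; last by rewrite -subSn.
  rewrite /negbin -mul_bin_diag.
  have -> : (n + (m - J.+1).+1 - 1 = m + n - J.+1)%N by lia.
  by congr (_ * 'C(_, _))%N; lia.
apply: (mulfI d1); rewrite E IH falling_ratioS; move: d0 d1.
move: (m + n)%:R (J.+1%:R : R) => s j1 d0 d1; field.
by rewrite d0 d1.
Qed.

Let r (J : nat) : R := (if (J <= m)%N then negbin n (m - J) else 0%N)%:R / (negbin n m)%:R.
Let sg : R := 1 - (1 - q) / 5.

(** Bernoulli's inequality for s = 1 - (1-q)/5.  With q <= s^5, five decay
    factors s^J are available: two pay for J^2 (1-q)^2 in [negbin_err] and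
    three are left for later sums, while 1 - s is still comparable to 1 - q. *)
Lemma saddle_le_expn5 : q <= sg ^+ 5.
Proof.
have q0 := saddle_ge0; have q1 := saddle_lt1.
have -> : q = 1 - 5 * ((1 - q) / 5) by field.
rewrite /sg; set x := (1 - q) / 5.
have x0 : 0 <= x by rewrite /x; lra.
have x1 : x <= 1 / 5 by rewrite /x; lra.
have h2 : 1 - 2 * x <= (1 - x) ^+ 2 by nra.
have h4 : 1 - 4 * x <= (1 - x) ^+ 4.
  have -> : (1 - x) ^+ 4 = ((1 - x) ^+ 2) ^+ 2 by rewrite -exprM.
  nra.
rewrite exprS; nra.
Qed.

(** Both the lower bound [falling_ratio_ge] and the correction
    (m+n)/(m+n-J) - 1 are polynomials in t = J (1-q) divided by n, and powers of
    t are absorbed by q^(J-1) through [geom_weight].  The assumption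
    m + n <= n^2 is used for J > (m+n)/2, where the correction may be as large as
    1/(1-q). *)
Lemma negbin_err J : (4 <= n)%N -> (m + n <= n ^ 2)%N ->
  `|r J - q ^+ J| <= 170 / n%:R * sg ^+ (3 * J).
Proof.
move=> n4 mn2; have q0 := saddle_ge0; have q1 := saddle_lt1; have A0 := a0.
have sg1 : sg <= 1 by rewrite /sg; lra.
have sg45 : 4 / 5 <= sg by rewrite /sg; lra.
have sg_ge0 : 0 <= sg by lra.
have nb0 : (negbin n m)%:R != 0 :> R by rewrite pnatr_eq0 -lt0n negbin_gt0.
case: J => [|J0].
  by rewrite /r leq0n subn0 divff // expr0 subrr normr0 mulr_ge0 ?exprn_ge0 // divr_ge0 // ltW.
set J := J0.+1; have J1 : 1 <= J%:R :> R by rewrite ler1n.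
have /andP[p0 pq] := falling_ratio_bounds J; have pl := falling_ratio_ge J n4.
set t := J%:R * (1 - q) in pl.
have t0 : 0 <= t by rewrite /t mulr_ge0; lra.
have rp : 0 <= r J - p J <= q ^+ J * (2 / n%:R * (t + t ^+ 2)).
  case: (leqP J m) => Jm; last first.
    rewrite /r leqNgt Jm /= mul0r falling_ratio_eq0 // subrr lexx /=.
    by rewrite !mulr_ge0 ?exprn_ge0 ?invr_ge0 ?addr_ge0 ?sqr_ge0 // ltW.
  have JmR : J%:R <= m%:R :> R by rewrite ler_nat.
  have d0 : 0 < (m + n)%:R - J%:R :> R by rewrite sE; lra.
  have -> : r J - p J = p J * (J%:R / ((m + n)%:R - J%:R)).
    rewrite /r Jm negbin_falling_ratio //; move: d0 nb0.
    move: (m + n)%:R ((negbin n m)%:R : R) => s nb d0 nb0; field.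
    by rewrite nb0 lt0r_neq0.
  apply/andP; split; first by rewrite mulr_ge0 // divr_ge0 ?ler0n // ltW.
  apply: ler_pM => //; first by rewrite divr_ge0 ?ler0n // ltW.
  have tE : t / n%:R = J%:R / (m + n)%:R.
    by rewrite /t saddle_1B; field; rewrite -sE !lt0r_neq0.
  case: (leqP J.*2 (m + n)) => hJ.
    apply: (@le_trans _ _ (2 * (J%:R / (m + n)%:R))).
      rewrite mulrA ler_pdivrMr // mulrAC ler_pdivlMr //.
      have : 2 * J%:R <= (m + n)%:R :> R by rewrite -natrM ler_nat; clear -hJ; lia.
      have := s0; nra.
    by rewrite -tE mulrCA mulrC; apply: ler_wpM2l; [rewrite divr_ge0 // ltW|nra].
  apply: (@le_trans _ _ (J%:R / n%:R)).
    by apply: ler_wpM2l; [rewrite ler0n|rewrite lef_pV2 ?posrE // sE; lra].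
  rewrite [leRHS]mulrAC ler_pM2r ?invr_gt0 //.
  suff : J%:R <= 2 * t ^+ 2 by nra.
  have -> : 2 * t ^+ 2 = J%:R * (2 * J%:R * n%:R ^+ 2 / (m + n)%:R ^+ 2).
    by rewrite /t saddle_1B; field; rewrite -sE lt0r_neq0.
  rewrite ler_peMr ?ler0n // ler_pdivlMr ?exprn_gt0 // mul1r.
  rewrite -!natrX -!natrM ler_nat expnS expn1; apply: leq_mul => //; clear -hJ; lia.
have E : `|r J - q ^+ J| <= q ^+ J.-1 * (3 * t ^+ 2 + 2 * t) / n%:R.
  have qq : q ^+ J <= q ^+ J.-1 by apply: ler_wiXn2l => //; exact: ltW.
  have -> : r J - q ^+ J = (r J - p J) - (q ^+ J - p J) by ring.
  apply: (le_trans (ler_normB _ _)).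
  case/andP: rp => rp0 rp; rewrite ger0_norm // ger0_norm ?subr_ge0 //.
  apply: (le_trans (lerD rp pl)).
  apply: (@le_trans _ _ (q ^+ J.-1 * (2 / n%:R * (t + t ^+ 2)) + q ^+ J.-1 * t ^+ 2 / n%:R)).
    rewrite lerD2r; apply: ler_wpM2r => //.
    by rewrite mulr_ge0 ?addr_ge0 ?sqr_ge0 // divr_ge0 // ltW.
  rewrite le_eqVlt; apply/orP; left; apply/eqP; field; exact: lt0r_neq0.
apply: (le_trans E).
rewrite [leRHS]mulrAC; apply: ler_wpM2r; first by rewrite invr_ge0 ltW.
pose h := sg ^+ J.-1; pose u := J%:R * (1 - sg).
have uh : u * h <= 1 by apply: geom_weight; rewrite sg_ge0.
have h0 : 0 <= h by rewrite exprn_ge0.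
have h1 : h <= 1 by rewrite exprn_ile1.
have u0 : 0 <= u by rewrite mulr_ge0 ?ler0n // subr_ge0.
have tu : t = 5 * u by rewrite /t /u /sg; field.
have gh : q ^+ J.-1 <= h ^+ 5.
  rewrite /h -exprM mulnC exprM; apply: lerXn2r; rewrite ?nnegrE ?exprn_ge0 //.
  exact: saddle_le_expn5.
have hE : sg ^+ (3 * J) = h ^+ 3 * sg ^+ 3.
  by rewrite /h -exprM -exprD; rewrite /J /= mulnS mulnC addnC.
(* Only s^(3(J-1)) is left at this point; s >= 4/5 restores the missing s^3. *)
have sg3 : 1 <= 2 * sg ^+ 3.
  have : (4 / 5) ^+ 2 <= sg ^+ 2 by apply: lerXn2r; rewrite ?nnegrE //; lra.
  rewrite [sg ^+ 3]exprSr; nra.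
rewrite tu hE.
apply: (@le_trans _ _ (85 * h ^+ 3)); last first.
  have : 0 <= h ^+ 3 by rewrite exprn_ge0.
  nra.
apply: (@le_trans _ _ (h ^+ 5 * (3 * (5 * u) ^+ 2 + 2 * (5 * u)))).
  by apply: ler_wpM2r => //; nra.
have -> : h ^+ 5 * (3 * (5 * u) ^+ 2 + 2 * (5 * u)) = h ^+ 3 * (75 * (u * h) ^+ 2 + 10 * (u * h) * h) by ring.
rewrite mulrC; apply: ler_wpM2r; first by rewrite exprn_ge0.
have uh0 : 0 <= u * h by rewrite mulr_ge0.
nra.
Qed.

End NegbinRatio.

(** * Sums over the box *)

Section BoxEstimate.
Variable R : realType.

Lemma boxsumB (N l : nat) (phi psi : nat -> nat -> R) :
  boxsum N l phi - boxsum N l psi = boxsum N l (fun K J => phi K J - psi K J).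
Proof.
elim: l phi psi => [|l IH] phi psi //=.
by rewrite -sumrB; apply: eq_bigr => k _; rewrite IH.
Qed.

Lemma boxsumD (N l : nat) (phi psi : nat -> nat -> R) :
  boxsum N l phi + boxsum N l psi = boxsum N l (fun K J => phi K J + psi K J).
Proof.
elim: l phi psi => [|l IH] phi psi //=.
by rewrite -big_split; apply: eq_bigr => k _; exact: IH.
Qed.

Lemma ler_norm_boxsum (N l : nat) (phi : nat -> nat -> R) :
  `|boxsum N l phi| <= boxsum N l (fun K J => `|phi K J|).
Proof.
elim: l phi => [|l IH] phi //=.
by apply: (le_trans (ler_norm_sum _ _ _)); apply: ler_sum => k _; apply: IH.
Qed.

Lemma sqr_le_tri k : (k ^ 2 <= (tri k).*2)%N.
Proof. by elim: k => // k IH; rewrite triS; nia. Qed.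

(** By Cauchy-Schwarz, (k_1 + ... + k_l)^2 <= 2 l (tri k_1 + ... + tri k_l), so a
    comparison of summands is only required under K^2 <= 2 l J. *)
Lemma ler_boxsum (N l : nat) (phi psi : nat -> nat -> R) :
  (forall K J, (K ^ 2 <= l * J.*2)%N -> phi K J <= psi K J) ->
  boxsum N l phi <= boxsum N l psi.
Proof.
elim: l phi psi => [|l IH] phi psi H /=; first exact: H.
apply: ler_sum => k _; apply: IH => K J KJ; apply: H.
have h1 := sqr_le_tri k.
apply: (@leq_trans (k ^ 2 + 2 * (k * K) + K ^ 2)); first by rewrite sqrnD addnAC.
(* Arithmetic-geometric mean: K^2 <= l S gives (2 k K)^2 <= 4 (l k^2) S. *)
have h2 : (2 * (k * K) <= l * k ^ 2 + J.*2)%N.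
  rewrite -(@leq_exp2r _ _ 2) //.
  apply: (@leq_trans (4 * (k ^ 2 * (l * J.*2)))).
    rewrite !expnMn leq_mul2l /= leq_mul2l; apply/orP; right; exact: KJ.
  have -> : (4 * (k ^ 2 * (l * J.*2)) = 4 * ((l * k ^ 2) * J.*2))%N by ring.
  exact: nat_AGM2.
rewrite doubleD; nia.
Qed.

(** A summand that is multiplicative in k factors over the coordinates. *)
Lemma boxsum_exp (N l : nat) (e s : R) :
  boxsum N l (fun K J => e ^+ K * s ^+ J) = (\sum_(k < N) e ^+ k * s ^+ tri k) ^+ l.
Proof.
elim: l => [|l IH]; first by rewrite /= !expr0 mulr1.
rewrite /= exprS -IH mulr_suml; apply: eq_bigr => k _; rewrite boxsumMl.
by apply: eq_boxsum => K J; rewrite !exprD; ring.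
Qed.

(** The weight 2K + c is a sum of contributions of single coordinates, so one
    coordinate at a time carries the weight: a Leibniz rule. *)
Lemma boxsum_expD (N l c : nat) (e s : R) :
  boxsum N l.+1 (fun K J => (K.*2 + c)%:R * (e ^+ K * s ^+ J)) =
  (\sum_(k < N) e ^+ k * s ^+ tri k) ^+ l *
  (l.+1%:R * (\sum_(k < N) k.*2%:R * (e ^+ k * s ^+ tri k)) +
   c%:R * \sum_(k < N) e ^+ k * s ^+ tri k).
Proof.
set f := \sum_(k < N) e ^+ k * _; set g := \sum_(k < N) k.*2%:R * _.
have H j : boxsum N j (fun K J => (K.*2)%:R * (e ^+ K * s ^+ J)) = j%:R * g * f ^+ j.-1.
  elim: j => [|j IH]; first by rewrite /= !mul0r.
  rewrite /= (eq_bigr (fun k : 'I_N => k.*2%:R * (e ^+ k * s ^+ tri k) * f ^+ j +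
      (e ^+ k * s ^+ tri k) * (j%:R * g * f ^+ j.-1))); last first.
    move=> k _; rewrite -IH -boxsum_exp !boxsumMl boxsumD; apply: eq_boxsum => K J.
    by rewrite doubleD natrD !exprD; ring.
  rewrite big_split /= -!mulr_suml -/f -/g -natr1.
  by case: j {IH} => [|j] /=; rewrite ?mul0r ?mulr0 ?exprS; ring.
under eq_boxsum do rewrite natrD mulrDl.
rewrite -boxsumD H -boxsumMl boxsum_exp -/f /= exprS; ring.
Qed.

(** Bound the terms k < M by 1 and the others by k/M times themselves, with
    M close to (1-s)^(-1/2).  The sum of k s^tri(k) is at most 1/(1-s), because
    consecutive values of tri differ by k. *)
Lemma sum_tri_le (N : nat) (s : R) : 0 <= s < 1 ->
  \sum_(k < N) s ^+ tri k <= 3 * Num.sqrt (1 - s)^-1.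
Proof.
move=> /andP[s0 s1]; set y := Num.sqrt _.
have s01 : 0 <= s <= 1 by rewrite s0 ltW.
have d0 : 0 < 1 - s by rewrite subr_gt0.
have y2 : y * y = (1 - s)^-1 by rewrite -expr2 sqr_sqrtr // invr_ge0 ltW.
have y1 : 1 <= y.
  by rewrite -sqrtr1; apply: ler_wsqrtr; rewrite invf_ge1 //; lra.
have S1 M : (1 - s) * \sum_(k < M.+1) k%:R * s ^+ tri k <= 1 - s ^+ tri M.
  elim: M => [|M IH]; first by rewrite big_ord1 mul0r mulr0 expr0 subrr.
  rewrite big_ord_recr mulrDr /=; apply: (le_trans (lerD IH (lexx _))).
  rewrite triS exprD.
  have := geom_weight_sharp M.+1 s01; rewrite /= exprS.
  have : 0 <= s ^+ tri M by rewrite exprn_ge0.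
  have : 0 <= s ^+ M by rewrite exprn_ge0.
  have := ler0n R M.+1.
  move: (M.+1%:R : R) (s ^+ M) (s ^+ tri M) => a b c a0 b0 c0 H.
  have H2 : (1 - s) * (a * (s * b)) <= a * (1 - s) * b.
    have : 0 <= a * (1 - s) * b by rewrite !mulr_ge0 // ltW.
    nra.
  by nra.
have S2 : \sum_(k < N) k%:R * s ^+ tri k <= y * y.
  rewrite y2 -[leRHS]mul1r ler_pdivlMr // mulrC.
  case: N => [|M]; first by rewrite big_ord0 mulr0.
  by apply: (le_trans (S1 M)); rewrite gerBl exprn_ge0.
(* The cut-off M satisfies y < M <= y + 1. *)
pose M := (Num.truncn y).+1.
have /andP[My yM] : (Num.truncn y)%:R <= y < M%:R by apply: truncn_itv; lra.
have M0 : 0 < M%:R :> R by rewrite ltr0n.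
have S3 : \sum_(k < N) s ^+ tri k <= \sum_(k < N) (if (k < M)%N then 1 else 0) +
    M%:R^-1 * \sum_(k < N) k%:R * s ^+ tri k.
  rewrite mulr_sumr -big_split; apply: ler_sum => k _ /=.
  have p0 : 0 <= s ^+ tri k by rewrite exprn_ge0.
  case: ltnP => kM.
    apply: (@le_trans _ _ 1); first by rewrite exprn_ile1 // ltW.
    by rewrite lerDl !mulr_ge0 ?invr_ge0 // ltW.
  rewrite add0r mulrA ler_peMl // mulrC ler_pdivlMr // mul1r ler_nat //.
have S4 : \sum_(k < N) (if (k < M)%N then 1 else 0) <= M%:R :> R.
  suff -> : \sum_(k < N) (if (k < M)%N then 1 else 0) = (minn N M)%:R :> R.
    by rewrite ler_nat geq_minr.
  elim: N {S2 S3} => [|N IH]; first by rewrite big_ord0 min0n.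
  rewrite big_ord_recr IH /=; case: ltnP => h.
    by rewrite (minn_idPl h) natr1.
  by rewrite addr0 (minn_idPr (leqW h)).
apply: (le_trans S3).
apply: (@le_trans _ _ (M%:R + y)).
  apply: lerD => //; rewrite mulrC ler_pdivrMr //; apply: (le_trans S2); nra.
have : M%:R = (Num.truncn y)%:R + 1 :> R by rewrite /M -natr1.
by lra.
Qed.

(** With l + 1 coordinates, (1+K)^3 <= (1+K)^4 <= 16 (l+1)^2 (1+J)^2 by
    Cauchy-Schwarz; two of the three decay
    factors s^J turn (1+J)^2 into (1-s)^(-2), and the third one leaves a power
    of [sum_tri_le]. *)
Lemma boxsum_weight_le (N l : nat) (s : R) : 0 <= s < 1 ->
  boxsum N l.+1 (fun K J => (1 + K%:R) ^+ 3 * s ^+ (3 * J)) <=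
  16 * l.+1%:R ^+ 2 * 3 ^+ l.+1 * Num.sqrt (1 - s)^-1 ^+ (l.+1 + 4).
Proof.
move=> s01; have /andP[s0 s1] := s01.
have d0 : 0 < 1 - s by rewrite subr_gt0.
set y := Num.sqrt _.
have y2 : y ^+ 2 = (1 - s)^-1 by rewrite sqr_sqrtr // invr_ge0 ltW.
apply: (@le_trans _ _ (boxsum N l.+1 (fun K J => 16 * l.+1%:R ^+ 2 * y ^+ 4 * (1 ^+ K * s ^+ J)))).
  apply: ler_boxsum => K J KJ; rewrite expr1n mul1r.
  have K0 := ler0n R K.
  apply: (@le_trans _ _ ((1 + K%:R) ^+ 4 * s ^+ (3 * J))).
    apply: ler_wpM2r; first by rewrite exprn_ge0.
    rewrite [leRHS]exprSr ler_peMr ?exprn_ge0; lra.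
  have h1 : (1 + K%:R) ^+ 2 <= 4 * l.+1%:R * J.+1%:R :> R.
    rewrite -[1]/(1%:R) -natrD -natrX -!natrM ler_nat; nia.
  have h2 : (1 + K%:R) ^+ 4 <= (4 * l.+1%:R * J.+1%:R) ^+ 2 :> R.
    rewrite (_ : 4 = 2 * 2)%N // exprM; apply: lerXn2r; rewrite ?nnegrE ?exprn_ge0 //; lra.
  apply: (le_trans (ler_wpM2r _ h2)); first by rewrite exprn_ge0.
  have -> : (3 * J = J * 2 + J)%N by ring.
  rewrite exprD exprM.
  have -> : (4 * l.+1%:R * J.+1%:R) ^+ 2 * ((s ^+ J) ^+ 2 * s ^+ J) =
     16 * l.+1%:R ^+ 2 * (J.+1%:R * s ^+ J) ^+ 2 * s ^+ J by ring.
  apply: ler_wpM2r; first by rewrite exprn_ge0.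
  apply: ler_wpM2l; first by rewrite mulr_ge0 // sqr_ge0.
  rewrite (_ : 4 = 2 * 2)%N // exprM y2; apply: lerXn2r.
  - by rewrite nnegrE mulr_ge0 ?exprn_ge0 ?ler0n.
  - by rewrite nnegrE invr_ge0 ltW.
  rewrite -[leRHS]mul1r ler_pdivlMr // mulrAC.
  by apply: (@geom_weight R s J.+1); rewrite s0 ltW.
rewrite -boxsumMl boxsum_exp.
under eq_bigr do rewrite expr1n mul1r.
rewrite [leRHS](_ : _ = 16 * l.+1%:R ^+ 2 * y ^+ 4 * (3 * y) ^+ l.+1); last first.
  by rewrite exprD exprMn; ring.
apply: ler_wpM2l; first by rewrite !mulr_ge0 ?exprn_ge0 ?sqrtr_ge0.
apply: lerXn2r; rewrite ?nnegrE ?mulr_ge0 ?sqrtr_ge0 //.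
  by apply: sumr_ge0 => k _; rewrite exprn_ge0.
exact: sum_tri_le.
Qed.

End BoxEstimate.

(** * The absolute error *)

Section MainError.
Variable R : realType.

Definition theta_sum (N : nat) (q : R) : R :=
  \sum_(k < N) (k.*2.+1)%:R * ((-1) ^+ k * q ^+ tri k).

Definition f_sum (N : nat) (q : R) : R := \sum_(k < N) (-1) ^+ k * q ^+ tri k.

(** What matters is that it depends on l alone. *)
Definition err_const (l : nat) : R :=
  2 ^+ l * l.+2%:R * (171 * l.+3%:R ^+ 2 + 170) * (16 * l.+1%:R ^+ 2 * 3 ^+ l.+1).

(** The comparison is made for truncated sums because these are finite; the
    bound is uniform in N, so N may tend to infinity afterwards. *)
Lemma main_error (l n m N : nat) (q : R) : q = m%:R / (m + n)%:R -> (4 <= n)%N -> (m + n <= n ^ 2)%N -> (n < N)%N ->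
  `|fps2_exp (T_fps R) l.+1 m n / ('C(n + m - 1, n - 1)%:R * catalan R n) -
    l.+1%:R * (2 * f_sum N q) ^+ l * theta_sum N q| <=
  err_const l / n%:R * Num.sqrt (5 * ((m + n)%:R / n%:R)) ^+ (l.+1 + 4).
Proof.
move=> qE n4 mn2 nN; have n0 : (0 < n)%N by apply: leq_trans n4.
have q0 : 0 <= q by rewrite qE saddle_ge0.
have q1 : q < 1 by rewrite qE saddle_lt1.
have q1B : 1 - q = n%:R / (m + n)%:R by rewrite qE saddle_1B.
pose sg := 1 - (1 - q) / 5.
have sg01 : 0 <= sg < 1 by rewrite /sg; apply/andP; split; lra.
have /andP[sg0 sg1] := sg01.
have qsg : q <= sg ^+ 5 by rewrite /sg qE saddle_le_expn5.
have nR : 0 < n%:R :> R by rewrite ltr0n.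
have mnR : 0 < (m + n)%:R :> R by rewrite ltr0n addn_gt0 n0 orbT.
have nb0 : (negbin n m)%:R != 0 :> R by rewrite pnatr_eq0 -lt0n negbin_gt0.
have C0 : catalan R n != 0 by rewrite lt0r_neq0 // catalan_gt0.
have -> : 'C(n + m - 1, n - 1) = negbin n m.
  rewrite /negbin -bin_sub; last by clear -n0; lia.
  by congr ('C(_, _)); clear -n0; lia.
have -> : 5 * ((m + n)%:R / n%:R) = (1 - sg)^-1.
  rewrite /sg q1B; move: nR mnR; move: ((m + n)%:R : R) (n%:R : R) => s a a0 s0.
  by field; rewrite subKr !lt0r_neq0.
rewrite (fps2_exp_boxsum R l.+1 m nN).
have -> : l.+1%:R * (2 * f_sum N q) ^+ l * theta_sum N q =
    2 ^+ l * boxsum N l.+1 (fun K J => (K.*2 + l.+1)%:R * ((-1) ^+ K * q ^+ J)).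
  rewrite boxsum_expD -/(f_sum N q).
  have -> : theta_sum N q = \sum_(k < N) k.*2%:R * ((-1) ^+ k * q ^+ tri k) + f_sum N q.
    rewrite /theta_sum /f_sum -big_split; apply: eq_bigr => k _ /=.
    by rewrite -natr1 mulrDl mul1r.
  by rewrite exprMn; ring.
rewrite mulrC !boxsumMl boxsumB.
apply: (le_trans (ler_norm_boxsum _ _ _)).
apply: (@le_trans _ _ (boxsum N l.+1 (fun K J =>
   2 ^+ l * l.+2%:R * (171 * l.+3%:R ^+ 2 + 170) / n%:R * ((1 + K%:R) ^+ 3 * sg ^+ (3 * J))))); last first.
  rewrite -boxsumMl /err_const.
  have c0 : 0 <= 2 ^+ l * l.+2%:R * (171 * l.+3%:R ^+ 2 + 170) / n%:R :> R.
    by rewrite divr_ge0 ?mulr_ge0 ?exprn_ge0 ?addr_ge0 ?mulr_ge0 ?exprn_ge0 // ltW.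
  apply: (le_trans (ler_wpM2l c0 (boxsum_weight_le N l sg01))).
  by rewrite le_eqVlt; apply/orP; left; apply/eqP; ring.
apply: ler_boxsum => K J _.
pose r : R := (if (J <= m)%N then negbin n (m - J) else 0%N)%:R / (negbin n m)%:R.
pose b : R := (ballot l.+1 K n)%:R / catalan R n.
pose w : R := (K.*2 + l.+1)%:R.
have -> : ((negbin n m)%:R * catalan R n)^-1 *
   ((-1) ^+ K * (ballot l.+1 K n)%:R * (if (J <= m)%N then negbin n (m - J) else 0%N)%:R) -
   2 ^+ l * ((K.*2 + l.+1)%:R * ((-1) ^+ K * q ^+ J)) =
   (-1) ^+ K * ((b - 2 ^+ l * w) * r + 2 ^+ l * w * (r - q ^+ J)).
  by rewrite invfM /r /b /w; ring.
rewrite normrM normrX normrN1 expr1n mul1r.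
have rerr : `|r - q ^+ J| <= 170 / n%:R * sg ^+ (3 * J).
  by rewrite /sg qE; exact: negbin_err.
have berr : `|b - 2 ^+ l * w| <= 2 ^+ l * w * (l.+3%:R ^+ 2 * (1 + K%:R) ^+ 2 / n%:R).
  exact: ballot_catalan_err.
have s3 : 0 <= sg ^+ (3 * J) by rewrite exprn_ge0.
have n1 : 170 / n%:R <= 170 :> R by rewrite ler_pdivrMr // ler_peMr // ler1n.
have qJ : q ^+ J <= sg ^+ (3 * J).
  rewrite exprM; apply: lerXn2r; rewrite ?nnegrE ?exprn_ge0 //.
  apply: (le_trans qsg); apply: ler_wiXn2l => //; exact: ltW.
have rle : `|r| <= 171 * sg ^+ (3 * J).
  have -> : r = (r - q ^+ J) + q ^+ J by ring.
  apply: (le_trans (ler_normD _ _)); rewrite [`|q ^+ J|]ger0_norm ?exprn_ge0 //.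
  have := ler_wpM2r s3 n1; lra.
have w0 : 0 <= w by rewrite ler0n.
have lw0 : 0 <= 2 ^+ l * w by rewrite mulr_ge0 ?exprn_ge0.
have wle : w <= l.+2%:R * (1 + K%:R).
  rewrite /w -[1]/(1%:R) -natrD -natrM ler_nat; clear; nia.
clearbody r b w.
have K1 : 1 <= 1 + K%:R :> R by rewrite lerDl.
apply: (le_trans (ler_normD _ _)); rewrite !normrM.
apply: (@le_trans _ _ (2 ^+ l * w * (l.+3%:R ^+ 2 * (1 + K%:R) ^+ 2 / n%:R) * (171 * sg ^+ (3 * J))
   + 2 ^+ l * w * (170 / n%:R * sg ^+ (3 * J)))).
  apply: lerD; first by apply: ler_pM.
  by rewrite [`|2 ^+ l|]ger0_norm ?exprn_ge0 // [`|w|]ger0_norm //; apply: ler_wpM2l.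
have -> : 2 ^+ l * w * (l.+3%:R ^+ 2 * (1 + K%:R) ^+ 2 / n%:R) * (171 * sg ^+ (3 * J))
   + 2 ^+ l * w * (170 / n%:R * sg ^+ (3 * J)) =
   2 ^+ l / n%:R * sg ^+ (3 * J) * (w * (171 * l.+3%:R ^+ 2 * (1 + K%:R) ^+ 2 + 170)).
  by ring.
have -> : 2 ^+ l * l.+2%:R * (171 * l.+3%:R ^+ 2 + 170) / n%:R *
   ((1 + K%:R) ^+ 3 * sg ^+ (3 * J)) =
   2 ^+ l / n%:R * sg ^+ (3 * J) *
   (l.+2%:R * (1 + K%:R) * ((171 * l.+3%:R ^+ 2 + 170) * (1 + K%:R) ^+ 2)) by ring.
apply: ler_wpM2l; first by rewrite mulr_ge0 // divr_ge0 ?exprn_ge0 // ltW.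
have A0 : 0 <= 171 * l.+3%:R ^+ 2 :> R by rewrite mulr_ge0 ?exprn_ge0.
have K2 : 1 <= (1 + K%:R) ^+ 2 :> R by rewrite exprn_ege1.
move: A0 K2; move: (171 * l.+3%:R ^+ 2) ((1 + K%:R) ^+ 2) => A k2 A0 K2.
apply: ler_pM => //; nra.
Qed.

End MainError.

(** * Jacobi's identity for the cube of the Euler product *)

Section Jacobi.
Variable R : realType.
Variable q : R.

Definition qpoch (N : nat) : R := \prod_(1 <= j < N.+1) (1 - q ^+ j).

Lemma qpoch0 : qpoch 0 = 1. Proof. by rewrite /qpoch big_geq. Qed.
Lemma qpochS N : qpoch N.+1 = qpoch N * (1 - q ^+ N.+1).
Proof. by rewrite /qpoch big_nat_recr. Qed.

(** The coefficient of z^(N+1+k) in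
    prod_{1<=i<=N} (1 - z q^i) prod_{0<=i<=N} (z - q^i).  This polynomial is
    antisymmetric under reversal, so the coefficients with k >= 0 determine it,
    and the coefficient for k = -1 is the opposite of the one for k = 0. *)
Fixpoint jacobi_coef (N k : nat) : R :=
  if N is N'.+1 then
    (1 + q ^+ N'.+1 ^+ 2) * jacobi_coef N' k - q ^+ N'.+1 * jacobi_coef N' k.+1
    - q ^+ N'.+1 * (if k is k'.+1 then jacobi_coef N' k' else - jacobi_coef N' 0)
  else (k == 0%N)%:R.

Definition jacobi_coef_prev (N k : nat) : R := if k is k'.+1 then jacobi_coef N k' else - jacobi_coef N 0.

Lemma jacobi_coefS N k : jacobi_coef N.+1 k = (1 + q ^+ N.+1 ^+ 2) * jacobi_coef N k
  - q ^+ N.+1 * jacobi_coef N k.+1 - q ^+ N.+1 * jacobi_coef_prev N k.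
Proof. by []. Qed.

Lemma jacobi_coef_gt N k : (N < k)%N -> jacobi_coef N k = 0.
Proof.
elim: N k => [|N IH] k; first by case: k.
by case: k => // k Nk /=; rewrite !IH ?mulr0 ?subr0 //; lia.
Qed.

(** The finite Jacobi triple product:
    jacobi_coef N k = (-1)^k q^tri(k) times the Gaussian binomial of 2N+1 over
    N - k.  Write X = q^k and Y = q^(N+1-k), so that X Y = q^(N+1).  The three
    terms of the recurrence, multiplied by the denominators at N + 1, become
    polynomials in X, Y, q with the common factor F, and the induction step is
    a polynomial identity. *)
Lemma jacobi_coef_formula N k : 0 < q -> (k <= N)%N ->
  jacobi_coef N k * (qpoch (N - k) * qpoch (N + k).+1) = (-1) ^+ k * q ^+ tri k * qpoch N.*2.+1.
Proof.
move=> q0; elim: N k => [|N IH] k kN.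
  by case: k kN => // _; rewrite /= qpoch0 !mul1r.
pose X := q ^+ k; pose Y := q ^+ (N.+1 - k).
pose F := (-1) ^+ k * q ^+ tri k * qpoch N.*2.+1.
have X0 : X != 0 by rewrite expf_neq0 // lt0r_neq0.
have XY : q ^+ N.+1 = X * Y by rewrite -exprD subnKC.
pose D := qpoch (N.+1 - k) * qpoch (N.+1 + k).+1.
have EX2 : q ^+ (N + k).+2 = X * Y * X * q.
  by rewrite -XY -exprD -exprSr; congr (_ ^+ _); clear; lia.
have EX1 : q ^+ (N + k).+1 = X * Y * X.
  by rewrite -XY -exprD; congr (_ ^+ _).
have DE : D = qpoch (N.+1 - k) * (qpoch (N + k).+1 * (1 - X * Y * X * q)).
  by rewrite /D addSn qpochS EX2.
(* The three terms of the recurrence; at k = N.+1 both sides of t1, t2 are 0. *)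
have t1 : jacobi_coef N k * D = F * ((1 - Y) * (1 - X * Y * X * q)).
  case: (leqP k N) => kN'.
    rewrite DE /F -IH // /Y subSn // qpochS; ring.
  have -> : k = N.+1 by clear -kN kN'; lia.
  rewrite jacobi_coef_gt // /Y; have -> : (N.+1 - k = 0)%N by clear -kN'; lia.
  by rewrite expr0 subrr; ring.
have t2 : jacobi_coef N k.+1 * D = - (X * F * ((q - Y) * (1 - Y))).
  case: (ltnP k N) => kN'.
    have := IH k.+1 kN'; rewrite addnS triS exprD !exprS -/X => H.
    have E1 : (N.+1 - k = (N - k.+1).+2)%N by clear -kN'; lia.
    have EY : Y = q ^+ (N - k.+1) * q ^+ 2 by rewrite /Y E1 -exprD addn2.
    rewrite /D E1 addSn [qpoch _.+2]qpochS qpochS -E1 -/Y.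
    transitivity ((jacobi_coef N k.+1 * (qpoch (N - k.+1) * qpoch (N + k).+2)) *
       ((1 - q ^+ (N - k.+1).+1) * (1 - Y))); first by ring.
    rewrite H /F [q ^+ (N - k.+1).+1]exprSr EY; ring.
  rewrite jacobi_coef_gt ?ltnS // mul0r.
  case: (eqVneq k N) => [kE|kE].
    by rewrite /Y kE subSnn expr1 subrr; ring.
  have -> : Y = 1 by rewrite /Y (_ : N.+1 - k = 0)%N //; move: kN kN' kE; clear; lia.
  by rewrite subrr; ring.
have t3 : X * (jacobi_coef_prev N k * D) =
    - (F * ((1 - X * Y * X) * (1 - X * Y * X * q))).
  have [k0|kpos] := posnP k.
    have X1 : X = 1 by rewrite /X k0 expr0.
    have YE : Y = q ^+ N.+1 by rewrite /Y k0 subn0.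
    have := IH 0%N (leq0n _); rewrite subn0 addn0 tri0 => H.
    have FE : F = jacobi_coef N 0 * (qpoch N * qpoch N.+1) by rewrite H /F k0 tri0.
    by rewrite DE FE X1 YE k0 subn0 addn0 !qpochS /jacobi_coef_prev; ring.
  have [k' kk] : exists k', k = k'.+1 by exists k.-1; rewrite prednK.
  have -> : jacobi_coef_prev N k = jacobi_coef N k' by rewrite kk.
  have k'N : (k' <= N)%N by rewrite -ltnS -kk.
  have H := IH k' k'N.
  have E1 : (N.+1 - k = N - k')%N by rewrite kk subSS.
  have E2 : (N + k = (N + k').+1)%N by rewrite kk addnS.
  rewrite DE E1 E2 qpochS.
  have -> : q ^+ (N + k').+2 = X * Y * X by rewrite -EX1 E2.
  transitivity (X * ((jacobi_coef N k' * (qpoch (N - k') * qpoch (N + k').+1)) *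
     ((1 - X * Y * X) * (1 - X * Y * X * q)))); first by ring.
  have FE : F = - ((-1) ^+ k' * q ^+ tri k' * qpoch N.*2.+1) * X.
    by rewrite /F /X kk triS exprD [(-1) ^+ _]exprS; ring.
  by rewrite H FE; ring.
apply: (mulfI X0).
rewrite -/D doubleS !qpochS.
have -> : q ^+ N.*2.+3 = (X * Y) ^+ 2 * q.
  by rewrite -XY -exprM -exprSr; congr (_ ^+ _); clear; lia.
have -> : q ^+ N.*2.+2 = (X * Y) ^+ 2.
  by rewrite -XY -exprM; congr (_ ^+ _); clear; lia.
rewrite jacobi_coefS XY.
transitivity (X * ((1 + (X * Y) ^+ 2) * (jacobi_coef N k * D) - X * Y * (jacobi_coef N k.+1 * D))
  - X * Y * (X * (jacobi_coef_prev N k * D))); first by ring.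
rewrite t1 t2 t3 /F qpochS; ring.
Qed.

(** The left side is the derivative at z = 1 of the polynomial above.  Summing by
    parts in the recurrence multiplies it by 1 - 2 Q + Q^2 with Q = q^(N+1); the
    boundary terms at k = 0 cancel by antisymmetry. *)
Lemma jacobi_coef_sum N M : (N < M)%N ->
  \sum_(k < M) (k.*2.+1)%:R * jacobi_coef N k = qpoch N ^+ 2.
Proof.
elim: N M => [|N IH] M NM.
  case: M NM => // M _; rewrite big_ord_recl qpoch0 expr1n big1 ?addr0 ?mulr1 //.
  by move=> k _; rewrite /= mulr0.
case: M NM => // M NM; set Q := q ^+ N.+1.
pose c (k : nat) : R := (k.*2.+1)%:R.
have cS k : c k.+1 = c k + 2 by rewrite /c doubleS -[_.+3]addn2 natrD.
have c0 : c 0%N = 1 by [].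
have S0 : \sum_(k < M.+1) c k * jacobi_coef N k = qpoch N ^+ 2 by apply: IH; lia.
have S1 : \sum_(k < M.+1) c k * jacobi_coef N k.+1 =
    \sum_(k < M.+1) (c k - 2) * jacobi_coef N k + jacobi_coef N 0.
  rewrite [in RHS]big_ord_recl big_ord_recr /= jacobi_coef_gt ?mulr0 ?addr0; last by lia.
  under [in RHS]eq_bigr => k _ do rewrite /bump add1n cS addrK.
  rewrite c0. ring.
have S2 : \sum_(k < M.+1) c k * jacobi_coef_prev N k =
    \sum_(k < M.+1) (c k + 2) * jacobi_coef N k - jacobi_coef N 0.
  rewrite [in LHS]big_ord_recl [in RHS]big_ord_recr /= [jacobi_coef N M]jacobi_coef_gt ?mulr0 ?addr0; last by lia.
  under [in LHS]eq_bigr => k _ do rewrite /bump add1n /= cS.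
  rewrite c0. ring.
rewrite (eq_bigr (fun k : 'I_M.+1 => (1 + Q ^+ 2) * (c k * jacobi_coef N k) - Q * (c k * jacobi_coef N k.+1)
   - Q * (c k * jacobi_coef_prev N k))); last first.
  by move=> k _; rewrite jacobi_coefS /c /Q; ring.
rewrite !sumrB -!mulr_sumr S1 S2 S0.
have -> : \sum_(k < M.+1) (c k - 2) * jacobi_coef N k =
    \sum_(k < M.+1) c k * jacobi_coef N k - 2 * \sum_(k < M.+1) jacobi_coef N k.
  by rewrite mulr_sumr -sumrB; apply: eq_bigr => k _; ring.
have -> : \sum_(k < M.+1) (c k + 2) * jacobi_coef N k =
    \sum_(k < M.+1) c k * jacobi_coef N k + 2 * \sum_(k < M.+1) jacobi_coef N k.
  by rewrite mulr_sumr -big_split; apply: eq_bigr => k _ /=; ring.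
rewrite S0 qpochS -/Q; ring.
Qed.

End Jacobi.

Section ThetaLimit.
Variable R : realType.
Variable q : R.
Hypothesis q01 : 0 <= q < 1.

Let q0 : 0 <= q. Proof. by case/andP: q01. Qed.
Let q1 : q < 1. Proof. by case/andP: q01. Qed.
Let qle1 : q <= 1. Proof. exact: ltW. Qed.

Lemma one_minus_expn j : 0 < 1 - q ^+ j.+1 <= 1.
Proof.
rewrite subr_gt0 gerBl exprn_ge0 // andbT exprn_ilt1 //.
Qed.

Lemma qpoch_gt0 N : 0 < qpoch q N.
Proof.
elim: N => [|N IH]; first by rewrite qpoch0.
by rewrite qpochS mulr_gt0 //; case/andP: (one_minus_expn N).
Qed.

Lemma qpoch_ratio a b : 1 - b%:R * q ^+ a <= qpoch q (a + b) / qpoch q a <= 1.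
Proof.
elim: b => [|b IH]; first by rewrite addn0 divff ?lt0r_neq0 ?qpoch_gt0 // mul0r subr0 lexx.
rewrite addnS qpochS mulrAC; move: IH; set r := _ / _ => /andP[IH1 IH2].
have /andP[h1 h2] := one_minus_expn (a + b).
have r0 : 0 <= r by rewrite divr_ge0 // ltW // qpoch_gt0.
have h3 : q ^+ (a + b).+1 <= q ^+ a by apply: ler_wiXn2l => //; lia.
have h4 : 0 <= q ^+ (a + b).+1 by rewrite exprn_ge0.
rewrite -natr1; apply/andP; split; last by nra.
have := ler0n R b; have := exprn_ge0 a q0; nra.
Qed.

(** Times prod_{j<=N} (1 - q^j), [jacobi_coef_sum] becomes theta with the k-th term
    multiplied by a quotient w k of products of 1 - q^i, which is within
    k q^(N-k) + N q^N of 1.  As tri(k) + N - k >= N, each term is off by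
    O(N^2 q^N). *)
Lemma theta_sum_err N :
  `|theta_sum N.+1 q - qpoch q N ^+ 3| <= 4 * N.+1%:R ^+ 3 * q ^+ N.
Proof.
have [qz|qn0] := eqVneq q 0.
  have -> : theta_sum N.+1 q = 1.
    rewrite /theta_sum big_ord_recl big1 ?addr0 ?tri0 ?mulr1 ?expr0 //= => k _.
    by rewrite /bump add1n triS addnS [q ^+ _]exprS qz mul0r !mulr0.
  have -> : qpoch q N = 1.
    by elim: N => [|N IH]; rewrite ?qpoch0 // qpochS IH qz exprS mul0r subr0 mulr1.
  by rewrite expr1n subrr normr0 !mulr_ge0 ?exprn_ge0.
have qp : 0 < q by rewrite lt_def qn0 q0.
pose w k := qpoch q N / qpoch q (N - k) * (qpoch q N.*2.+1 / qpoch q (N + k).+1).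
have jE k : (k <= N)%N -> qpoch q N * jacobi_coef q N k = (-1) ^+ k * q ^+ tri k * w k.
  move=> kN; have := jacobi_coef_formula qp kN => H.
  have P1 : qpoch q (N - k) * qpoch q (N + k).+1 != 0.
    by rewrite mulf_neq0 // lt0r_neq0 // qpoch_gt0.
  apply: (mulIf P1); rewrite -[LHS]mulrA H /w; field.
  by rewrite !lt0r_neq0 ?qpoch_gt0.
have wb k : (k <= N)%N -> 0 <= q ^+ tri k * (1 - w k) <= 2 * N%:R * q ^+ N.
  move=> kN; have := qpoch_ratio (N - k) k; rewrite subnK // => /andP[a1 a2].
  have := qpoch_ratio (N + k).+1 (N - k).
  rewrite (_ : (N + k).+1 + (N - k) = N.*2.+1)%N; last by clear -kN; lia.
  move=> /andP[b1 b2].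
  have a0 : 0 <= qpoch q N / qpoch q (N - k) by rewrite divr_ge0 // ltW // qpoch_gt0.
  have b0 : 0 <= qpoch q N.*2.+1 / qpoch q (N + k).+1 by rewrite divr_ge0 // ltW // qpoch_gt0.
  move: a0 b0 a1 a2 b1 b2; rewrite /w.
  move: (qpoch q N / _) (qpoch q N.*2.+1 / _) => A B A0 B0 A1 A2 B1 B2.
  have T0 : 0 <= q ^+ tri k by rewrite exprn_ge0.
  have T1 : q ^+ tri k <= 1 by rewrite exprn_ile1.
  apply/andP; split; first by rewrite mulr_ge0 // subr_ge0; nra.
  have h1 : q ^+ (N + k).+1 <= q ^+ N by apply: ler_wiXn2l => //; clear; lia.
  have h2 : q ^+ tri k * q ^+ (N - k) <= q ^+ N.
    rewrite -exprD; apply: ler_wiXn2l => //.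
    case: k kN {A1 B1 T0 T1 h1} => [|k] kN; first by rewrite subn0 leq_addl.
    by rewrite triS; move: kN; clear; lia.
  have NkR : (N - k)%:R <= N%:R :> R by rewrite ler_nat leq_subr.
  have kR : k%:R <= N%:R :> R by rewrite ler_nat.
  have Q0 : 0 <= q ^+ N by rewrite exprn_ge0.
  have Q1 : 0 <= q ^+ (N + k).+1 by rewrite exprn_ge0.
  have Q2 : 0 <= q ^+ (N - k) by rewrite exprn_ge0.
  have k0 := ler0n R k. have Nk0 := ler0n R (N - k).
  have m1 : (N - k)%:R * q ^+ (N + k).+1 <= N%:R * q ^+ N by apply: ler_pM.
  have m2 : 1 - A * B <= k%:R * q ^+ (N - k) + N%:R * q ^+ N by nra.
  apply: (le_trans (ler_wpM2l T0 m2)).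
  have m3 : q ^+ tri k * (k%:R * q ^+ (N - k)) <= N%:R * q ^+ N.
    by rewrite mulrCA; apply: ler_pM => //; rewrite mulr_ge0.
  have m4 : q ^+ tri k * (N%:R * q ^+ N) <= N%:R * q ^+ N.
    by rewrite ler_piMl // mulr_ge0.
  by rewrite mulrDr; move: m3 m4; rewrite -[2 * N%:R * _]mulrA; move: (N%:R * q ^+ N) => z; lra.
have E : theta_sum N.+1 q - qpoch q N ^+ 3 =
    \sum_(k < N.+1) (k.*2.+1)%:R * ((-1) ^+ k * (q ^+ tri k * (1 - w k))).
  rewrite exprS -(jacobi_coef_sum q (ltnSn N)) mulr_sumr /theta_sum -sumrB.
  apply: eq_bigr => k _; rewrite [X in _ - X]mulrCA jE -1?ltnS //; ring.
rewrite E; apply: (le_trans (ler_norm_sum _ _ _)).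
apply: (@le_trans _ _ (\sum_(k < N.+1) 2 * N.+1%:R * (2 * N.+1%:R * q ^+ N))); last first.
  rewrite sumr_const card_ord -mulr_natl le_eqVlt; apply/orP; left; apply/eqP; ring.
apply: ler_sum => k _; have kN : (k <= N)%N by rewrite -ltnS.
have /andP[h1 h2] := wb k kN.
rewrite !normrM normrX normrN1 expr1n mul1r normr_nat -normrM ger0_norm //.
apply: ler_pM => //.
  by rewrite -natrM ler_nat; move: kN; clear; lia.
apply: (le_trans h2); apply: ler_wpM2r; first by rewrite exprn_ge0.
by apply: ler_wpM2l => //; rewrite ler_nat.
Qed.

Lemma qpoch3_cvg : (fun N => qpoch q N ^+ 3) @ \oo --> euler_prod3 q.
Proof.
have -> : euler_prod3 q = limn (fun N => qpoch q N ^+ 3).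
  by rewrite /euler_prod3; congr (limn _); apply/funext => N; rewrite prodrXl.
apply: nonincreasing_is_cvgn.
  have qpoch_ge0 n := ltW (qpoch_gt0 n).
  apply/nonincreasing_seqP => N; apply: lerXn2r; rewrite ?nnegrE ?qpoch_ge0 //.
  by rewrite qpochS ler_piMr ?qpoch_ge0 //; case/andP: (one_minus_expn N).
by exists 0 => _ [N _ <-]; rewrite exprn_ge0 // ltW // qpoch_gt0.
Qed.

(** Jacobi's identity: by [theta_sum_err] the partial sums of theta approach the
    partial products of the cubed Euler product. *)
Lemma theta_sum_cvg : (fun N => theta_sum N q) @ \oo --> euler_prod3 q.
Proof.
rewrite -(cvg_shiftS (fun N => theta_sum N q)).
have -> : (fun N => theta_sum N.+1 q) =
  (fun N => qpoch q N ^+ 3 + (theta_sum N.+1 q - qpoch q N ^+ 3)).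
  by apply/funext => N; ring.
suff dif0 : (fun N => theta_sum N.+1 q - qpoch q N ^+ 3) @ \oo --> (0 : R).
  by rewrite -[euler_prod3 q]addr0; exact: cvgD qpoch3_cvg dif0.
(* q <= s^4: three factors s^N absorb (N+1)^3, the fourth tends to 0. *)
pose s := 1 - (1 - q) / 4.
have s0 : 0 <= s by rewrite /s; have := q0; lra.
have s1 : s < 1 by rewrite /s; have := q1; lra.
have qs : q <= s ^+ 4.
  have -> : q = 1 - 4 * ((1 - q) / 4) by field.
  rewrite /s; set x := (1 - q) / 4.
  have x0 : 0 <= x by rewrite /x; have := q1; lra.
  have x1 : x <= 1 / 4 by rewrite /x; have := q0; lra.
  have h2 : 1 - 2 * x <= (1 - x) ^+ 2 by nra.
  have -> : (1 - x) ^+ 4 = ((1 - x) ^+ 2) ^+ 2 by rewrite -exprM.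
  nra.
have c0 : 0 < 1 - s by rewrite subr_gt0.
have bnd N : `|theta_sum N.+1 q - qpoch q N ^+ 3| <= 4 * (1 - s)^-1 ^+ 3 * s ^+ N.
  apply: (le_trans (theta_sum_err N)).
  have h : N.+1%:R * s ^+ N <= (1 - s)^-1.
    rewrite -[leRHS]mul1r ler_pdivlMr // mulrAC.
    by apply: (@geom_weight R s N.+1); rewrite s0 ltW.
  apply: (@le_trans _ _ (4 * (N.+1%:R * s ^+ N) ^+ 3 * s ^+ N)).
    have -> : 4 * (N.+1%:R * s ^+ N) ^+ 3 * s ^+ N = 4 * N.+1%:R ^+ 3 * (s ^+ 4) ^+ N.
      by rewrite -exprM mulnC exprM; ring.
    apply: ler_wpM2l; first by rewrite mulr_ge0 ?exprn_ge0.
    by apply: lerXn2r => //; rewrite nnegrE exprn_ge0.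
  apply: ler_wpM2r; first by rewrite exprn_ge0.
  apply: ler_wpM2l => //; apply: lerXn2r => //; rewrite nnegrE.
    by rewrite mulr_ge0 ?exprn_ge0.
  by rewrite invr_ge0 ltW.
have lim0 : (fun N => 4 * (1 - s)^-1 ^+ 3 * s ^+ N) @ \oo --> (0 : R).
  have cs : (fun N => s ^+ N) @ \oo --> (0 : R) by apply: cvg_expr; rewrite ger0_norm.
  rewrite -(mulr0 (4 * (1 - s)^-1 ^+ 3)).
  exact: cvgM (cvg_cst _) cs.
apply: norm_cvg0.
apply: (squeeze_cvgr _ (cvg_cst 0) lim0).
by near=> N; rewrite normr_ge0 bnd.
Unshelve. all: by end_near.
Qed.

End ThetaLimit.

(** * The upper bound in the Basel problem *)

Section Basel.
Variable R : realType.

Lemma sin_le_id (x : R) : 0 <= x -> sin x <= x.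
Proof.
move=> x0; have [c _ H] : exists2 c, c \in `[0, x]%R & sin x - sin 0 = cos c * (x - 0).
  apply: (MVT_segment (f := @sin R) (df := @cos R)) => //.
  by apply: derivable_within_continuous => y _; exact: derivable_sin.
move: H; rewrite sin0 !subr0 => ->; have := cos_le1 c; nra.
Qed.

(** 1/s^2 + 1/c^2 = 1/(s c)^2 for the sine s and cosine c of x/2. *)
Lemma inv_sin2_half (x : R) : 0 < x < pi ->
  (sin x ^+ 2)^-1 = 4^-1 * ((sin (x / 2) ^+ 2)^-1 + (sin ((x + pi) / 2) ^+ 2)^-1).
Proof.
move=> /andP[x0 xpi].
have s0 : 0 < sin (x / 2) by apply: sin_gt0_pihalf; lra.
have c0 : 0 < cos (x / 2) by apply: cos_gt0_pihalf; lra.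
have -> : sin ((x + pi) / 2) = cos (x / 2) by rewrite mulrDl sinDpihalf.
have -> : sin x = 2 * (cos (x / 2) * sin (x / 2)).
  have {1}-> : x = (x / 2) *+ 2 by rewrite mulr2n; field.
  by rewrite sin_mulr2n mulr2n; ring.
have := cos2Dsin2 (x / 2); move: (sin (x / 2)) (cos (x / 2)) s0 c0 => s c s0 c0 E.
have -> : (s ^+ 2)^-1 + (c ^+ 2)^-1 = (c ^+ 2 + s ^+ 2) / (s ^+ 2 * c ^+ 2).
  by field; rewrite !lt0r_neq0.
by rewrite E; field; rewrite !lt0r_neq0.
Qed.

Lemma sum_inv_sin2 n (x : R) : 0 < x < pi ->
  \sum_(k < 2 ^ n) (sin ((x + k%:R * pi) / 2 ^+ n) ^+ 2)^-1 = 4 ^+ n / sin x ^+ 2.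
Proof.
elim: n x => [|n IH] x /andP[x0 xpi].
  by rewrite expn0 big_ord1 mul0r addr0 expr0 divr1 mul1r.
have pi0 := pi_gt0 R.
have H1 : 0 < x / 2 < pi by lra.
have H2 : 0 < (x + pi) / 2 < pi by lra.
rewrite inv_sin2_half ?x0 // [4 ^+ _]exprS.
transitivity (4 ^+ n / sin (x / 2) ^+ 2 + 4 ^+ n / sin ((x + pi) / 2) ^+ 2).
  2: by rewrite mulrACA mulfV ?pnatr_eq0 // mul1r mulrDr.
rewrite -(IH _ H1) -(IH _ H2).
have dbl m (F : nat -> R) : \sum_(k < m.*2) F k = \sum_(k < m) F k.*2 + \sum_(k < m) F k.*2.+1.
  elim: m => [|m IHm]; first by rewrite !big_ord0 addr0.
  by rewrite doubleS !big_ord_recr IHm /=; ring.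
rewrite expnS mul2n (dbl _ (fun k => (sin ((x + k%:R * pi) / 2 ^+ n.+1) ^+ 2)^-1)).
congr (_ + _); apply: eq_bigr => k _; congr ((sin _ ^+ 2)^-1); rewrite exprS.
  by rewrite -muln2 natrM; field; rewrite expf_neq0.
by rewrite -[k.*2.+1]addn1 -muln2 natrD natrM; field; rewrite expf_neq0.
Qed.

(** Evaluate [sum_inv_sin2] at x = pi/2.  The angles (2k+1) pi / 2^(n+2) are
    symmetric about pi/2, and for those below pi/2 the inequality sin t <= t
    bounds 1/sin^2 t from below by 1/t^2. *)
Lemma sum_odd_sqr_pow2 n :
  \sum_(k < 2 ^ n) ((k.*2.+1)%:R ^+ 2)^-1 <= pi ^+ 2 / 8 :> R.
Proof.
have pi0 := pi_gt0 R.
have H : 0 < (pi / 2 : R) < pi.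
  by lra.
have := sum_inv_sin2 n.+1 H; rewrite sin_pihalf expr1n divr1 expnS mul2n => E.
pose a : R := pi ^+ 2 / (4 * 4 ^+ n.+1).
have a0 : 0 < a by rewrite /a divr_gt0 ?exprn_gt0 // mulr_gt0 // exprn_gt0.
have angE (k : nat) : (pi / 2 + k%:R * pi) / 2 ^+ n.+1 = k.*2.+1%:R * (pi / 2 ^+ n.+2) :> R.
  rewrite -[k.*2.+1]addn1 -muln2 natrD natrM [2 ^+ n.+2]exprS; field.
  by rewrite expf_neq0.
have aE : (pi / 2 ^+ n.+2) ^+ 2 = a :> R.
  rewrite /a -exprS expr_div_n -exprM mulnC exprM.
  by congr (_ / _ ^+ _); rewrite -natrX.
have bnd (t : R) : 0 < t < pi -> (t ^+ 2)^-1 <= (sin t ^+ 2)^-1.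
  move=> tb; have s0 := sin_gt0_pi tb; case/andP: tb => t0 _.
  rewrite lef_pV2 ?posrE ?exprn_gt0 //; apply: lerXn2r; rewrite ?nnegrE; [exact: ltW|exact: ltW|].
  by apply: sin_le_id; exact: ltW.
have p2 : 0 < 2 ^+ n.+2 :> R by rewrite exprn_gt0.
have ang_in (k : nat) : (k < (2 ^ n).*2)%N -> 0 < (k.*2.+1%:R * (pi / 2 ^+ n.+2) : R) < pi.
  move=> kn; rewrite mulr_gt0 ?ltr0n ?divr_gt0 //= mulrA ltr_pdivrMr // mulrC ltr_pM2l //.
  rewrite -natrX ltr_nat !expnS; move: kn; lia.
have main : 2 * \sum_(k < 2 ^ n) ((k.*2.+1)%:R ^+ 2 * a)^-1 <= 4 ^+ n.+1.
  rewrite -E mulr_natl mulr2n -addnn big_split_ord /=; apply: lerD.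
    apply: ler_sum => k _; rewrite angE -aE -exprMn; apply/bnd/ang_in.
    by rewrite (leq_trans (ltn_ord k)) // -addnn leq_addr.
  rewrite [leRHS](reindex_inj rev_ord_inj) /=; apply: ler_sum => k _.
  rewrite angE -aE -exprMn.
  have -> : (2 ^ n + (2 ^ n - k.+1)).*2.+1%:R * (pi / 2 ^+ n.+2) =
      pi - k.*2.+1%:R * (pi / 2 ^+ n.+2) :> R.
    have piE : pi = (2 ^ n.+2)%:R * (pi / 2 ^+ n.+2) :> R.
      by rewrite natrX mulrCA divff ?mulr1 // lt0r_neq0.
    rewrite [X in _ = X - _]piE -mulrBl -natrB; last by rewrite !expnS; have := ltn_ord k; lia.
    by rewrite !expnS; congr (_%:R * _); have := ltn_ord k; lia.
  rewrite sinB cospi sinpi mul0r sub0r mulN1r opprK.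
  apply/bnd/ang_in; by rewrite (leq_trans (ltn_ord k)) // -addnn leq_addr.
move: main; under eq_bigr do rewrite invfM.
rewrite -mulr_suml; move: (\sum_(k < _) _) => S main.
have : S <= 4 ^+ n.+1 / 2 * a.
  by rewrite -ler_pdivrMr // ler_pdivlMr // mulrC.
rewrite /a; have -> : 4 ^+ n.+1 / 2 * (pi ^+ 2 / (4 * 4 ^+ n.+1)) = pi ^+ 2 / 8 :> R.
  by field; rewrite expf_neq0.
by [].
Qed.

Lemma sum_odd_sqr M : \sum_(k < M) ((k.*2.+1)%:R ^+ 2)^-1 <= pi ^+ 2 / 8 :> R.
Proof.
apply: le_trans (sum_odd_sqr_pow2 M).
have ML : (M <= 2 ^ M)%N by rewrite ltnW // ltn_expl.
rewrite (big_ord_widen _ (fun k => ((k.*2.+1)%:R ^+ 2)^-1 : R) ML) big_mkcond /=.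
by apply: ler_sum => k _; case: ifP => _ //; rewrite invr_ge0 exprn_ge0.
Qed.

(** If S is the sum over i <= M, the sum over i <= 2M is S/4 plus the sum over odd
    numbers, so S <= pi^2/8 + S/4. *)
Lemma sum_inv_sqr M : \sum_(k < M) (k.+1%:R ^+ 2)^-1 <= pi ^+ 2 / 6 :> R.
Proof.
set S := \sum_(k < M) _.
have H : \sum_(k < M.*2) (k.+1%:R ^+ 2)^-1 =
    \sum_(k < M) ((k.*2.+1)%:R ^+ 2)^-1 + 4^-1 * S :> R.
  rewrite /S; elim: M {S} => [|M IH]; first by rewrite !big_ord0 mulr0 addr0.
  rewrite doubleS !big_ord_recr IH /= mulrDr.
  have -> : (M.*2.+2%:R ^+ 2)^-1 = 4^-1 * (M.+1%:R ^+ 2)^-1 :> R.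
    by rewrite -doubleS -mul2n natrM exprMn invfM; congr (_^-1 * _); ring.
  ring.
have le1 : S <= \sum_(k < M.*2) (k.+1%:R ^+ 2)^-1 :> R.
  have ML : (M <= M.*2)%N by rewrite -addnn leq_addr.
  rewrite /S (big_ord_widen _ (fun k => (k.+1%:R ^+ 2)^-1 : R) ML) big_mkcond /=.
  by apply: ler_sum => k _; case: ifP => _ //; rewrite invr_ge0 exprn_ge0.
have := sum_odd_sqr M; lra.
Qed.

End Basel.

(** * A lower bound for the Euler product *)

Section ProductLowerBound.
Variable R : realType.

(** The difference between - ln (1 - x) and its Taylor polynomial of degree M
    vanishes at 0 and has derivative x^M/(1-x). *)
Lemma Nln1B_le (x : R) (M : nat) : 0 <= x < 1 ->
  - ln (1 - x) <= \sum_(i < M) x ^+ i.+1 / i.+1%:R + x ^+ M.+1 / (1 - x).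
Proof.
move=> /andP[x0 x1].
pose f (n : nat) (t : R) := \sum_(i < n) t ^+ i.+1 / i.+1%:R.
have df n (t : R) : is_derive t 1 (f n) (\sum_(i < n) t ^+ i).
  pose p : {poly R} := \sum_(i < n) i.+1%:R^-1 *: 'X^(i.+1).
  have -> : f n = horner p.
    apply/funext => y; rewrite /f /p horner_sum; apply: eq_bigr => i _.
    by rewrite hornerZ hornerXn mulrC.
  have -> : \sum_(i < n) t ^+ i = p^`().[t].
    rewrite /p raddf_sum horner_sum; apply: eq_bigr => i _ /=.
    by rewrite derivZ derivXn hornerZ hornerMn hornerXn -[X in _ = _ * X]mulr_natl mulrA mulVf ?mul1r.
  exact: is_derive_poly.
have dl (t : R) : t < 1 -> is_derive t 1 (fun t : R => ln (1 - t)) (- (1 - t)^-1).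
  move=> t1; have p0 : 0 < 1 - t by rewrite subr_gt0.
  have H1 := is_derive1_ln p0.
  have H2 : is_derive t 1 (fun t : R => 1 - t) (-1).
    have -> : -1 = 0 - 1 :> R by rewrite sub0r.
    exact: is_deriveB.
  have := is_derive1_comp (f := @ln R) (g := fun t : R => 1 - t) (x := t).
  by move=> /(_ _ _ H1 H2); rewrite mulrN1.
pose g (t : R) := f M t + ln (1 - t).
have dg (t : R) : t < 1 -> is_derive t 1 g (\sum_(i < M) t ^+ i - (1 - t)^-1).
  by move=> t1; have h1 := df M t; have h2 := dl t t1; exact: is_deriveD.
have [c cin H] : exists2 c, c \in `[0, x]%R &
    g x - g 0 = (\sum_(i < M) c ^+ i - (1 - c)^-1) * (x - 0).
  apply: (MVT_segment (f := g) (df := fun c => \sum_(i < M) c ^+ i - (1 - c)^-1)) => //.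
    move=> y; rewrite in_itv /= => /andP[_ yx]; apply: dg; lra.
  apply: derivable_within_continuous => y; rewrite in_itv /= => /andP[_ yx].
  by have [] := dg y (le_lt_trans yx x1).
move: cin; rewrite in_itv /= => /andP[c0 cx].
have c1 : c < 1 by lra.
have g0 : g 0 = 0.
  rewrite /g /f subr0 ln1 addr0 big1 // => i _.
  by rewrite exprS mul0r mul0r.
rewrite g0 !subr0 in H.
have dc : \sum_(i < M) c ^+ i - (1 - c)^-1 = - (c ^+ M / (1 - c)).
  have cn : 1 - c != 0 by rewrite lt0r_neq0 // subr_gt0.
  apply: (mulfI cn); have -> : (1 - c) * (\sum_(i < M) c ^+ i - (1 - c)^-1) =
    - ((c - 1) * \sum_(i < M) c ^+ i) - 1 by field.
  by rewrite -subrX1; field.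
rewrite dc in H.
have : c ^+ M / (1 - c) * x <= x ^+ M.+1 / (1 - x).
  rewrite exprSr mulrAC; apply: ler_pM.
  - by rewrite mulr_ge0 ?exprn_ge0.
  - by rewrite invr_ge0; lra.
  - by apply: ler_wpM2r => //; apply: lerXn2r; rewrite ?nnegrE.
  - by rewrite lef_pV2 ?posrE ?subr_gt0 //; lra.
move: H; rewrite /g /f mulNr; lra.
Qed.

Lemma bernoulli_quadratic (h : R) i : 0 <= h ->
  1 + i%:R * h + i%:R * (i%:R - 1) / 2 * h ^+ 2 <= (1 + h) ^+ i.
Proof.
move=> h0; elim: i => [|i IH]; first by rewrite expr0 !mul0r !addr0.
rewrite [(1 + h) ^+ _]exprSr; apply: (@le_trans _ _ ((1 + i%:R * h + i%:R * (i%:R - 1) / 2 * h ^+ 2) * (1 + h))).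
  rewrite -natr1; have : 0 <= i%:R * (i%:R - 1) / 2 * h ^+ 3.
    rewrite mulr_ge0 ?exprn_ge0 // divr_ge0 //; case: i {IH} => [|i]; first by rewrite mul0r.
    by rewrite mulr_ge0 // subr_ge0 ler1n.
  lra.
by apply: ler_wpM2r => //; lra.
Qed.

Lemma harmonic_ge_ln m : ln m.+1%:R <= \sum_(i < m) i.+1%:R^-1 :> R.
Proof.
elim: m => [|m IH]; first by rewrite big_ord0 ln1.
rewrite big_ord_recr /=.
have m0 : 0 < m.+1%:R :> R by rewrite ltr0n.
have -> : m.+2%:R = m.+1%:R * (1 + m.+1%:R^-1) :> R.
  by rewrite mulrDr mulr1 mulfV ?lt0r_neq0 // natr1.
rewrite lnM ?posrE ?addr_gt0 ?invr_gt0 //; apply: lerD => //.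
by apply: le_ln1Dx; rewrite (lt_trans (ltrN10 _)) // invr_gt0.
Qed.

Variable lam : R.
Hypothesis lam0 : 0 < lam.
Let q : R := lam / (1 + lam).

Let q01 : 0 <= q < 1.
Proof.
rewrite /q divr_ge0 ?addr_ge0 ?ltW //= ltr_pdivrMr ?mul1r ?addr_gt0 //.
by rewrite ltrDr.
Qed.

Let q_gt0 : 0 < q. Proof. by rewrite divr_gt0 // addr_gt0. Qed.

Let ratioE : lam * (1 - q) = q.
Proof. by rewrite /q; field; rewrite lt0r_neq0 // addr_gt0. Qed.

Let c (i : nat) : R := q ^+ i / (1 - q ^+ i).

Lemma geom_ratio_le i : c i.+1 <= lam / i.+1%:R.
Proof.
have /andP[p0 _] := one_minus_expn q01 i.
rewrite /c ler_pdivrMr // mulrAC ler_pdivlMr ?ltr0n //.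
have := @geom_weight_sharp R q i.+1.
have /andP[h0 h1] := q01; rewrite h0 ltW // => /(_ isT) H.
apply: (le_trans _ (ler_wpM2l (ltW lam0) H)).
have -> : lam * (i.+1%:R * (1 - q) * q ^+ i.+1.-1) = lam * (1 - q) * (i.+1%:R * q ^+ i) by rewrite /=; ring.
by rewrite ratioE exprS le_eqVlt; apply/orP; left; apply/eqP; ring.
Qed.

(** With h = 1/lambda, the quotient is 1/((1+h)^(i+1) - 1).  The second-order
    Bernoulli inequality improves the bound of [geom_ratio_le] by the factor
    1/(1 + i h/2), which is at most 1 - i h/3 as long as i h <= 1. *)
Lemma geom_ratio_le_sharp i : i.+1%:R <= lam ->
  c i.+1 <= lam / i.+1%:R - i%:R / (3 * i.+1%:R).
Proof.
move=> ilam; pose h := lam^-1.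
have h0 : 0 < h by rewrite invr_gt0.
have lh : lam * h = 1 by rewrite mulfV // lt0r_neq0.
have qh : q * (1 + h) = 1.
  by rewrite /q /h; field; rewrite !lt0r_neq0 // addr_gt0.
have B := bernoulli_quadratic i.+1 (ltW h0).
have i0 : 0 < i.+1%:R :> R by rewrite ltr0n.
have iE : i.+1%:R = i%:R + 1 :> R by rewrite natr1.
have in0 := ler0n R i.
set P := (1 + h) ^+ i.+1 in B.
have qP : q ^+ i.+1 * P = 1 by rewrite /P -exprMn qh expr1n.
have D0 : 0 < i.+1%:R * h * (1 + i%:R * h / 2).
  by rewrite !mulr_gt0 // ltr_wpDr // divr_ge0 // mulr_ge0 // ltW.
have P1 : i.+1%:R * h * (1 + i%:R * h / 2) <= P - 1.
  by move: B; rewrite iE addrK; lra.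
have PP : 0 < P - 1 by apply: lt_le_trans P1.
have Pn : P != 0 by apply: lt0r_neq0; lra.
have cE : c i.+1 = (P - 1)^-1.
  have -> : c i.+1 = P^-1 / (1 - P^-1).
    by rewrite /c; have -> : q ^+ i.+1 = P^-1 by apply: (mulIf Pn); rewrite qP mulVf.
  by field; rewrite Pn lt0r_neq0.
rewrite cE; apply: (@le_trans _ _ (i.+1%:R * h * (1 + i%:R * h / 2))^-1).
  by rewrite lef_pV2 ?posrE.
rewrite -[leLHS]mul1r ler_pdivrMr //.
have ih : i%:R * h <= 1.
  apply: (@le_trans _ _ (lam * h)); last by rewrite lh.
  apply: ler_wpM2r; first exact: ltW.
  by apply: le_trans ilam; rewrite ler_nat.
have -> : (lam / i.+1%:R - i%:R / (3 * i.+1%:R)) * (i.+1%:R * h * (1 + i%:R * h / 2))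
  = (lam * h - i%:R * h / 3) * (1 + i%:R * h / 2).
  by field; rewrite lt0r_neq0.
rewrite lh; move: ih; have : 0 <= i%:R * h by rewrite mulr_ge0 // ltW.
move: (i%:R * h) => u u0 u1; nra.
Qed.

(** Expand each logarithm, exchange the sums, and sum the geometric series over
    j; the last term bounds the tails of the logarithmic series. *)
Lemma qpoch_ln N M :
  - ln (qpoch q N) <= \sum_(i < M) i.+1%:R^-1 * c i.+1 + N%:R * (q ^+ M / (1 - q)).
Proof.
have /andP[h0 h1] := q01; have hq : 0 < 1 - q by rewrite subr_gt0.
have -> : - ln (qpoch q N) = \sum_(j < N) - ln (1 - q ^+ j.+1).
  elim: N => [|N IH]; first by rewrite qpoch0 ln1 oppr0 big_ord0.
  rewrite qpochS lnM ?posrE ?qpoch_gt0 //; last by case/andP: (one_minus_expn q01 N).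
  by rewrite opprD IH big_ord_recr.
apply: (@le_trans _ _ (\sum_(j < N) (\sum_(i < M) (q ^+ j.+1) ^+ i.+1 / i.+1%:R
     + q ^+ M / (1 - q)))).
  apply: ler_sum => j _.
  have qj : 0 <= q ^+ j.+1 < 1 by rewrite exprn_ge0 // exprn_ilt1.
  apply: (le_trans (Nln1B_le M qj)); apply: lerD => //.
  have /andP[k0 k1] := qj.
  apply: ler_pM; rewrite ?exprn_ge0 ?invr_ge0 ?subr_ge0 ?(ltW k1) //.
    rewrite -exprM; apply: ler_wiXn2l => //; first exact: ltW.
    by rewrite mulSn; lia.
  rewrite lef_pV2 ?posrE ?subr_gt0 // lerD2l lerN2 exprS ler_piMr //.
  by rewrite exprn_ile1 // ltW.
rewrite big_split /= sumr_const card_ord [N%:R * _]mulr_natl lerD2r exchange_big /=.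
apply: ler_sum => i _; rewrite -mulr_suml mulrC; apply: ler_wpM2l; first by rewrite invr_ge0.
have /andP[p0 p1] := one_minus_expn q01 i.
rewrite /c ler_pdivlMr //.
have -> : \sum_(j < N) (q ^+ j.+1) ^+ i.+1 = q ^+ i.+1 * \sum_(j < N) (q ^+ i.+1) ^+ j.
  by rewrite mulr_sumr; apply: eq_bigr => j _; rewrite -exprS -!exprM mulnC.
rewrite -mulrA ler_piMr ?exprn_ge0 // mulrC -[leLHS]opprK -mulNr opprB -subrX1 opprB.
by rewrite gerBl !exprn_ge0.
Qed.

(** The refined bound applies to the m terms with i <= lambda; the saving is a
    third of a harmonic sum up to m, minus a third of sum 1/i^2.  The additive
    3 covers the latter, since pi^2/6 < 3. *)
Lemma sum_ratio_le M : lam <= M%:R ->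
  3 * \sum_(i < M) i.+1%:R^-1 * c i.+1 <= pi ^+ 2 / 2 * lam - ln ((1 + lam) / 2) + 3.
Proof.
move=> lamM; pose m := Num.truncn lam.
have /andP[m1 m2] : m%:R <= lam < m.+1%:R by apply: truncn_itv; exact: ltW.
have mM : (m <= M)%N by rewrite -(ler_nat R); exact: le_trans lamM.
have term (i : 'I_M) : i.+1%:R^-1 * c i.+1 <=
    lam * (i.+1%:R ^+ 2)^-1 - 3^-1 * (if (i < m)%N then i.+1%:R^-1 - (i.+1%:R ^+ 2)^-1 else 0).
  have i0 : 0 < i.+1%:R :> R by rewrite ltr0n.
  have iv : 0 <= i.+1%:R^-1 :> R by rewrite invr_ge0 ltW.
  case: ltnP => im.
    have il : i.+1%:R <= lam by apply: le_trans m1; rewrite ler_nat.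
    apply: (le_trans (ler_wpM2l iv (geom_ratio_le_sharp il))).
    rewrite -[i.+1%:R]natr1 le_eqVlt; apply/orP; left; apply/eqP; field.
    by rewrite natr1 lt0r_neq0.
  rewrite mulr0 subr0; apply: (le_trans (ler_wpM2l iv (geom_ratio_le i))).
  by rewrite le_eqVlt; apply/orP; left; apply/eqP; field; rewrite lt0r_neq0.
have S1 : \sum_(i < M) i.+1%:R^-1 * c i.+1 <=
    lam * (\sum_(i < M) (i.+1%:R ^+ 2)^-1) -
    3^-1 * (\sum_(i < m) i.+1%:R^-1 - \sum_(i < m) (i.+1%:R ^+ 2)^-1).
  apply: (le_trans (ler_sum _ (fun i _ => term i))).
  rewrite sumrB -!mulr_sumr -big_mkcond /= -sumrB.
  by rewrite (big_ord_widen _ (fun i => i.+1%:R^-1 - (i.+1%:R ^+ 2)^-1 : R) mM).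
have B1 := sum_inv_sqr R M. have B2 := sum_inv_sqr R m.
have H := harmonic_ge_ln m.
have pi2 : pi ^+ 2 <= 16 :> R.
  have := pihalf_lt2 R; have := pi_gt0 R; nra.
have L : ln ((1 + lam) / 2) <= ln m.+1%:R.
  have mm : 1 <= m.+1%:R :> R by rewrite ler1n.
  by rewrite ler_ln ?posrE; lra.
have B3 := ler_wpM2l (ltW lam0) B1.
lra.
Qed.

(** Exponentiate [qpoch_ln] and [sum_ratio_le].  Nothing depends on N, so the
    bound survives in the infinite product. *)
Lemma qpoch3_ge N :
  (1 + lam) / 2 * expR (- 3) * expR (- (pi ^+ 2 / 2 * lam)) <= qpoch q N ^+ 3.
Proof.
have /andP[h0 h1] := q01; have hq : 0 < 1 - q by rewrite subr_gt0.
have qN := qpoch_gt0 q01 N.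
have l2 : 0 < (1 + lam) / 2 by have := lam0; lra.
suff H : 3 * - ln (qpoch q N) <= pi ^+ 2 / 2 * lam - ln ((1 + lam) / 2) + 3.
  rewrite -{1}[(1 + lam) / 2]lnK ?posrE // -[qpoch q N]lnK ?posrE //.
  rewrite -!expRD -expRM_natr ler_expR; lra.
(* The term N q^M/(1-q) of [qpoch_ln] vanishes as M tends to infinity. *)
apply/ler_addgt0Pr => e e0.
have cv : (fun M => 3 * (N%:R * (q ^+ M / (1 - q)))) @ \oo --> (0 : R).
  have cs : (fun M => q ^+ M) @ \oo --> (0 : R) by apply: cvg_expr; rewrite ger0_norm.
  have -> : (fun M => 3 * (N%:R * (q ^+ M / (1 - q)))) =
     (fun M => 3 * N%:R / (1 - q) * q ^+ M) by apply/funext => M; ring.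
  rewrite -(mulr0 (3 * N%:R / (1 - q))).
  exact: cvgM (cvg_cst _) cs.
have near1 : \forall M \near \oo, 3 * (N%:R * (q ^+ M / (1 - q))) < e.
  exact: (cvgr_lt _ cv).
have near2 : \forall M \near \oo, lam <= M%:R.
  exact: nbhs_infty_ger.
have [M [h2 h3]] : exists M : nat, 3 * (N%:R * (q ^+ M / (1 - q))) < e /\ lam <= M%:R.
  have /filter_ex[M [H1 H2]] : \forall M \near \oo, 3 * (N%:R * (q ^+ M / (1 - q))) < e /\ lam <= M%:R.
    by near=> M; split; near: M.
  by exists M.
have := sum_ratio_le h3; have := qpoch_ln N M; lra.
Unshelve. all: by end_near.
Qed.

End ProductLowerBound.

(** * The alternating series f *)

Section FSeries.
Variable R : realType.

Lemma cvg_exprn (u : nat -> R) (a : R) (l : nat) :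
  u @ \oo --> a -> (fun N => u N ^+ l) @ \oo --> a ^+ l.
Proof.
move=> ua; elim: l => [|l IH]; first by rewrite expr0; under eq_fun do rewrite expr0; exact: cvg_cst.
rewrite exprS; have -> : (fun N => u N ^+ l.+1) = (fun N => u N * u N ^+ l).
  by apply/funext => N; rewrite exprS.
exact: cvgM.
Qed.

Variable q : R.
Hypothesis q01 : 0 <= q < 1.

Lemma f_sum_cvg : (fun N => f_sum N q) @ \oo --> f_series q.
Proof.
have /andP[q0 q1] := q01.
have E : (fun N => f_sum N q) = series (fun k => (-1) ^+ k * q ^+ tri k).
  by apply/funext => N; rewrite /series /= /f_sum big_mkord.
have -> : f_series q = limn (series (fun k => (-1) ^+ k * q ^+ tri k)) by [].
rewrite E; apply: normed_cvg.
apply: (@series_le_cvg _ _ (geometric 1 q)) => [k|k|k|].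
- exact: normr_ge0.
- by rewrite /= mul1r exprn_ge0.
- rewrite /= mul1r normrM normrX normrN1 expr1n mul1r ger0_norm ?exprn_ge0 //.
  apply: ler_wiXn2l => //; first exact: ltW.
  by elim: k => // k IH; rewrite triS; lia.
- by apply: is_cvg_geometric_series; rewrite ger0_norm.
Qed.

(** Let d k = q^tri(k) - q^tri(k+1).  The d k sum to 1, f is the sum of those with
    even k, and d (k+1) <= 2 d k; hence 1 <= 3 f in the limit. *)
Lemma f_sum_ge N : 1 - q ^+ N <= 3 * f_sum N q.
Proof.
have /andP[q0 q1] := q01.
have fS k : f_sum k.+1 q = f_sum k q + (-1) ^+ k * q ^+ tri k.
  by rewrite /f_sum big_ord_recr.
have even M : 1 - q ^+ tri M.*2 <= 3 * f_sum M.*2 q.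
  elim: M => [|M IH]; first by rewrite /f_sum big_ord0 expr0 subrr mulr0.
  rewrite doubleS !fS -[(-1) ^+ _.+1]signr_odd -[(-1) ^+ M.*2]signr_odd /= odd_double /= expr0 expr1.
  rewrite !triS !exprD; move: IH; set a := q ^+ tri _.
  set b := q ^+ (M.*2).+1 => IH.
  have a0 : 0 <= a by rewrite exprn_ge0.
  have b0 : 0 <= b by rewrite exprn_ge0.
  have b1 : b <= q.
    by rewrite /b -[leRHS]expr1; apply: ler_wiXn2l => //; exact: ltW.
  have -> : q ^+ M.*2.+2 = b * q by rewrite -exprSr.
  have b1' : b <= 1 by lra.
  have H1 : b * (1 - q) <= 1 - q by rewrite ler_piMl //; lra.
  have H2 : 0 <= b * (1 - q) by rewrite mulr_ge0 //; lra.
  have H3 : b * (1 - b * q) <= 1 - b * q by rewrite ler_piMl //; lra.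
  have H : b * (1 - b * q) <= 2 * (1 - b) by lra.
  have := ler_wpM2l a0 H; nra.
have tri_ge k : (k <= tri k)%N by elim: k => // k IH; rewrite triS; lia.
rewrite -[N]odd_double_half; case: (odd N); rewrite ?add1n ?add0n.
  rewrite fS -signr_odd odd_double expr0 mul1r.
  have := even N./2; have := exprn_ge0 (tri N./2.*2) q0.
  have := exprn_ge0 (N./2.*2).+1 q0; lra.
apply: le_trans (even _); rewrite lerD2l lerN2.
by apply: ler_wiXn2l => //; exact: ltW.
Qed.

Lemma f_series_ge : 3^-1 <= f_series q.
Proof.
have /andP[q0 q1] := q01.
suff : 1 <= 3 * f_series q by lra.
have H1 : (fun N => 3 * f_sum N q + q ^+ N) @ \oo --> 3 * f_series q + 0.
  apply: cvgD; last by apply: cvg_expr; rewrite ger0_norm.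
  by apply: cvgM; [exact: cvg_cst|exact: f_sum_cvg].
rewrite -[leRHS]addr0; apply: (cvgr_to_ge H1).
by near=> N; have := f_sum_ge N; lra.
Unshelve. all: by end_near.
Qed.

End FSeries.

(** * The relative error *)

Section Asymptotics.
Variable R : realType.

Lemma euler_prod3_ge (lam : R) : 0 <= lam ->
  (1 + lam) / 2 * expR (- 3) * expR (- (pi ^+ 2 / 2 * lam)) <=
  euler_prod3 (lam / (1 + lam)).
Proof.
rewrite le_eqVlt => /orP[/eqP<-|lam0].
  have q01 : 0 <= (0 : R) < 1 by rewrite lexx ltr01.
  rewrite mul0r; apply: (cvgr_to_ge (qpoch3_cvg q01)); near=> N.
  have -> : qpoch (0 : R) N = 1.
    by elim: (N) => [|k IH]; rewrite ?qpoch0 // qpochS IH exprS mul0r subr0 mulr1.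
  rewrite expr1n mulr0 oppr0 expR0 mulr1 addr0.
  have : expR (- 3) <= 1 :> R by rewrite expR_le1; lra.
  by have := expR_gt0 (- 3 : R); nra.
have q01 : 0 <= lam / (1 + lam) < 1.
  rewrite divr_ge0 ?addr_ge0 ?(ltW lam0) //= ltr_pdivrMr ?mul1r ?addr_gt0 //.
  by rewrite ltrDr.
apply: (cvgr_to_ge (qpoch3_cvg q01)); near=> N; exact: qpoch3_ge.
Unshelve. all: by end_near.
Qed.

(** The error of [main_error] carries ((1+lambda)^(1/2))^(l+5) for the power
    l + 1; dividing by the main term removes one factor 1 + lambda and brings
    in exp(pi^2 lambda / 2). *)
Lemma relative_error (l n m : nat) (lam : R) : (4 <= n)%N -> (m + n <= n ^ 2)%N ->
  lam = m%:R / n%:R ->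
  let q := m%:R / (m + n)%:R in
  let main : R := l.+1%:R * (2 * f_series q) ^+ l * euler_prod3 q in
  0 < main /\
  `|fps2_exp (T_fps R) l.+1 m n / ('C(n + m - 1, n - 1)%:R * catalan R n) / main - 1| <=
  (err_const R l / ((2 / 3) ^+ l) * 2 * expR 3 * 5) *
  Num.sqrt (5 * (1 + lam)) ^+ l.+3 * (expR (pi ^+ 2 / 2 * lam) / n%:R).
Proof.
move=> n4 mn2 lamE q main.
have n0 : (0 < n)%N by apply: leq_trans n4.
have nR : 0 < n%:R :> R by rewrite ltr0n.
have lam0 : 0 <= lam by rewrite lamE divr_ge0.
have mnR : 0 < (m + n)%:R :> R by rewrite ltr0n addn_gt0 n0 orbT.
have q01 : 0 <= q < 1 by rewrite /q saddle_ge0 saddle_lt1.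
have lE : 1 + lam = (m + n)%:R / n%:R.
  by rewrite lamE natrD mulrDl divff ?lt0r_neq0 // addrC.
have qE : q = lam / (1 + lam).
  rewrite lE lamE /q; move: nR mnR; move: ((m + n)%:R : R) (n%:R : R) => s a a0 s0.
  by field; rewrite !lt0r_neq0.
have fge := f_series_ge q01.
have Pge := euler_prod3_ge lam0; rewrite -qE in Pge.
set P0 := (1 + lam) / 2 * _ * _ in Pge.
have P0gt : 0 < P0.
  by rewrite /P0 !mulr_gt0 ?expR_gt0 ?invr_gt0 //; lra.
have Pgt : 0 < euler_prod3 q by apply: lt_le_trans Pge.
have f23 : (2 / 3) ^+ l <= (2 * f_series q) ^+ l :> R.
  by apply: lerXn2r; rewrite ?nnegrE; lra.
have f230 : 0 < (2 / 3) ^+ l :> R by rewrite exprn_gt0 //; lra.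
have mge : (2 / 3) ^+ l * P0 <= main.
  rewrite /main -mulrA; apply: (@le_trans _ _ ((2 * f_series q) ^+ l * euler_prod3 q)).
    by apply: ler_pM => //; apply: ltW.
  rewrite ler_peMl ?ler1n // mulr_ge0 ?ltW //.
  by apply: lt_le_trans f23.
have m0 : 0 < main by apply: lt_le_trans mge; rewrite mulr_gt0.
split=> //.
set X := _ / ('C(_, _)%:R * _).
have XT : `|X - main| <= err_const R l / n%:R * Num.sqrt (5 * (1 + lam)) ^+ (l.+1 + 4).
  have cv : (fun N => `|X - l.+1%:R * (2 * f_sum N q) ^+ l * theta_sum N q|) @ \oo --> `|X - main|.
    apply: cvg_norm; apply: cvgB; first exact: cvg_cst.
    apply: cvgM; last exact: theta_sum_cvg.
    apply: cvgM; first exact: cvg_cst.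
    apply: cvg_exprn; apply: cvgM; first exact: cvg_cst.
    exact: f_sum_cvg.
  apply: (cvgr_to_le cv); near=> N.
  rewrite lE; apply: main_error => //; near: N; exact: nbhs_infty_gt.
have -> : X / main - 1 = (X - main) / main by rewrite mulrBl divff ?lt0r_neq0.
rewrite normrM normfV [`|main|]gtr0_norm //.
set y := Num.sqrt (5 * (1 + lam)) in XT *.
have y2 : y ^+ 2 = 5 * (1 + lam) by rewrite sqr_sqrtr // mulr_ge0 // addr_ge0.
have y0 : 0 <= y by rewrite sqrtr_ge0.
have e0 : 0 <= err_const R l.
  by rewrite /err_const; do ?[exact: ler0n|apply: mulr_ge0|apply: addr_ge0|apply: exprn_ge0].
(* The factor 1 + lam of the lower bound is y^2 / 5. *)
have P0E : P0^-1 = 2 * expR 3 * 5 / y ^+ 2 * expR (pi ^+ 2 / 2 * lam).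
  rewrite y2 /P0 !invfM -!expRN !opprK invrK; field.
  by rewrite lt0r_neq0; lra.
apply: (@le_trans _ _ (err_const R l / n%:R * y ^+ (l.+1 + 4) / ((2 / 3) ^+ l * P0))).
  apply: ler_pM => //; first by rewrite invr_ge0 ltW.
  by rewrite lef_pV2 // posrE // mulr_gt0.
rewrite invfM P0E.
have yn0 : y != 0 by rewrite -sqrf_eq0 y2 lt0r_neq0 //; lra.
have -> : y ^+ (l.+1 + 4) = y ^+ l.+3 * y ^+ 2 by rewrite -exprD !addSn !addnS addn0.
rewrite le_eqVlt; apply/orP; left; apply/eqP.
move: (err_const R l) ((2 / 3) ^+ l) f230 (y ^+ l.+3) (expR _) (expR _) (n%:R) nR => A B B0 Y E1 E2 a a0.
by field; rewrite yn0 !lt0r_neq0.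
Unshelve. all: by end_near.
Qed.

End Asymptotics.

(** With z = (log n)^(1/2), the hypothesis reads
    exp(pi^2 lambda / 2) <= n z^(-(l+3)) exp(-w), and (5 (1+lambda))^(1/2) <= 4 z
    since 1 + lambda <= 2 log n. *)
Lemma exp_bound (R : realType) (l n : nat) (lam w : R) :
  (0 < n)%N -> 0 <= lam -> 0 <= w -> 1 <= ln (n%:R : R) ->
  lam <= 2 / pi ^+ 2 * (ln n%:R - 2^-1 * (l.+1%:R + 2) * ln (ln n%:R) - w) ->
  Num.sqrt (5 * (1 + lam)) ^+ l.+3 * (expR (pi ^+ 2 / 2 * lam) / n%:R) <=
  4 ^+ l.+3 * expR (- w).
Proof.
move=> n0 lam0 w0 L1 H.
have nR : 0 < n%:R :> R by rewrite ltr0n.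
set L := ln (n%:R : R) in L1 H *.
have L0 : 0 < L by lra.
have pi0 : 0 < pi ^+ 2 :> R by rewrite exprn_gt0 // pi_gt0.
have pi4 : 4 <= pi ^+ 2 :> R by have := pi_ge2 R; nra.
have lnL : 0 <= ln L by rewrite ln_ge0.
have H2 : pi ^+ 2 / 2 * lam <= L - 2^-1 * (l.+1%:R + 2) * ln L - w.
  have c0 : 0 <= pi ^+ 2 / 2 :> R by lra.
  apply: (le_trans (ler_wpM2l c0 H)); rewrite mulrA.
  have -> : pi ^+ 2 / 2 * (2 / pi ^+ 2) = 1 :> R by move: (pi ^+ 2 : R) pi0 => p p0; field; rewrite lt0r_neq0.
  by rewrite mul1r.
pose z := expR (2^-1 * ln L).
have z0 : 0 < z by rewrite expR_gt0.
have z2 : z ^+ 2 = L.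
  by rewrite /z -expRM_natr mulrAC mulVf ?mul1r ?lnK ?posrE ?pnatr_eq0.
have lamL : 2 * lam <= L.
  have : 0 <= 2^-1 * (l.+1%:R + 2) * ln L :> R by rewrite !mulr_ge0 // addr_ge0.
  have : 4 / 2 * lam <= pi ^+ 2 / 2 * lam by apply: ler_wpM2r => //; lra.
  lra.
set y := Num.sqrt _.
have y0 : 0 <= y by rewrite sqrtr_ge0.
have yz : y <= 4 * z.
  rewrite -(ler_pXn2r (_ : 0 < 2)%N) ?nnegrE ?mulr_ge0 ?(ltW z0) //.
  rewrite sqr_sqrtr ?mulr_ge0 ?addr_ge0 // exprMn z2; lra.
have E : expR (pi ^+ 2 / 2 * lam) / n%:R <= (z ^+ l.+3)^-1 * expR (- w).
  rewrite ler_pdivrMr //.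
  have -> : (z ^+ l.+3)^-1 = expR (- (2^-1 * (l.+1%:R + 2) * ln L)).
    rewrite expRN /z -expRM_natr; congr ((expR _)^-1).
    by rewrite -[l.+3]addn2 natrD; ring.
  have -> : n%:R = expR L :> R by rewrite lnK.
  rewrite -!expRD ler_expR; lra.
apply: (le_trans (ler_pM _ _ (lexx _) E)); first by rewrite exprn_ge0.
  by rewrite divr_ge0 ?expR_ge0.
rewrite mulrA; apply: ler_wpM2r; first exact: expR_ge0.
by rewrite ler_pdivrMr ?exprn_gt0 // -exprMn; apply: lerXn2r; rewrite ?nnegrE ?mulr_ge0 ?(ltW z0).
Qed.

Unset Implicit Arguments.

Theorem lemma2p4 (R : realType) (l : nat) (m : nat -> nat) (omega : nat -> R)
    (hl : (1 <= l)%N)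
    (homega : omega n @[n --> \oo] --> +oo)
    (hm : \forall n \near \oo,
      (m n)%:R <= 2 / pi ^+ 2 * n%:R *
        (ln n%:R - 2^-1 * (l%:R + 2) * ln (ln n%:R) - omega n) :> R) :
  let q (n : nat) : R := (m n)%:R / (m n + n)%:R in
  asymp_equiv
    (fun n : nat => fps2_exp (T_fps R) l (m n) n)
    (fun n : nat =>
      l%:R * (2 * f_series (q n)) ^+ (l - 1) * 'C(n + m n - 1, n - 1)%:R *
      catalan R n * euler_prod3 (q n)).
Proof.
case: l hl hm => // l _ hm q; rewrite /asymp_equiv subn1 /=.
set ratio := (fun n : nat => _ / _).
pose c : R := err_const R l / ((2 / 3) ^+ l) * 2 * expR 3 * 5.
have c0 : 0 <= c.
  rewrite /c /err_const; do ?[exact: ler0n|exact: expR_ge0|apply: mulr_ge0|apply: addr_ge0|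
    apply: exprn_ge0|rewrite invr_ge0].
have bound : \forall n \near \oo, `|ratio n - 1| <= c * 4 ^+ l.+3 * expR (- omega n).
  have n4near : \forall n \near \oo, (4 <= n)%N by exact: nbhs_infty_ge.
  have nE : \forall n \near \oo, expR 1 <= n%:R :> R by exact: nbhs_infty_ger.
  have w0near : \forall n \near \oo, 0 <= omega n by move/cvgryPge: homega; exact.
  near=> n.
  have n4 : (4 <= n)%N by near: n.
  have w0 : 0 <= omega n by near: n.
  have n0 : (0 < n)%N by apply: leq_trans n4.
  have nR : 0 < n%:R :> R by rewrite ltr0n.
  have L1 : 1 <= ln (n%:R : R).
    have e1 : expR 1 <= n%:R :> R by near: n.
    by rewrite -[leLHS](@expRK R) ler_ln ?posrE ?expR_gt0.
  pose lam : R := (m n)%:R / n%:R.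
  have lam0 : 0 <= lam by rewrite divr_ge0.
  have lamle : lam <= 2 / pi ^+ 2 *
      (ln n%:R - 2^-1 * (l.+1%:R + 2) * ln (ln n%:R) - omega n).
    by rewrite /lam ler_pdivrMr // mulrAC; near: n.
  have lnL : 0 <= ln (ln (n%:R : R)) by rewrite ln_ge0.
  have pi4 : 4 <= pi ^+ 2 :> R by have := pi_ge2 R; nra.
  have mn2 : (m n + n <= n ^ 2)%N.
    have Ln : ln (n%:R : R) <= n%:R - 1.
      have -> : n%:R = 1 + (n%:R - 1) :> R by ring.
      by rewrite {2}[1 + _]addrC addrK; apply: le_ln1Dx; lra.
    (* The hypothesis gives lam <= log n <= n - 1. *)
    have lam1 : lam <= n%:R - 1.
      apply: (le_trans lamle); apply: (@le_trans _ _ (1 * ln (n%:R : R))); last by rewrite mul1r.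
      have t0 : 0 <= 2^-1 * (l.+1%:R + 2) * ln (ln (n%:R : R)) by rewrite !mulr_ge0 // addr_ge0.
      apply: (@le_trans _ _ (2 / pi ^+ 2 * ln (n%:R : R))).
        by apply: ler_wpM2l; [rewrite divr_ge0 // sqr_ge0|lra].
      by apply: ler_wpM2r; [lra|rewrite ler_pdivrMr ?mul1r; lra].
    rewrite -(ler_nat R) natrD natrX expr2 -lerBrDr -{3}[n%:R]mul1r -mulrBl.
    by rewrite -ler_pdivrMr.
  have [T0 err] := @relative_error R l n (m n) lam n4 mn2 (erefl lam).
  have ratioE : ratio n = fps2_exp (T_fps R) l.+1 (m n) n /
      ('C(n + m n - 1, n - 1)%:R * catalan R n) /
      (l.+1%:R * (2 * f_series (q n)) ^+ l * euler_prod3 (q n)).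
    by rewrite /ratio -[RHS]mulrA -invfM; congr (_ / _); ring.
  rewrite ratioE; apply: (le_trans err); rewrite -mulrA -[leRHS]mulrA.
  apply: ler_wpM2l => //.
  by apply: exp_bound.
have exp0 : expR (- omega n) @[n --> \oo] --> (0 : R).
  exact: (@cvg_comp _ _ _ omega (fun x : R => expR (- x)) _ _ _ homega (@cvgr_expR R)).
have lim0 : (fun n => c * 4 ^+ l.+3 * expR (- omega n)) @ \oo --> (0 : R).
  by rewrite -(mulr0 (c * 4 ^+ l.+3)); exact: cvgM (cvg_cst _) exp0.
have dif0 : (fun n => ratio n - 1) @ \oo --> (0 : R).
  apply: norm_cvg0; apply: (squeeze_cvgr _ (cvg_cst 0) lim0).
  by near=> n; rewrite normr_ge0 /=; near: n.
rewrite -[X in _ --> X]addr0.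
have -> : ratio = (fun n => 1 + (ratio n - 1)) by apply/funext => n; ring.
exact: cvgD (cvg_cst _) dif0.
Unshelve. all: by end_near.
Qed.
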